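(* Let $k$ be a field, let $n \geqslant 5$ be an integer, let $L_n = k(x_1,\dots,x_n)$ where $x_1,\dots,x_n$ are independent variables, and let $K_n \subset L_n$ be the field of cross-ratios. Let $S$ be a subgroup of the symmetric group $\Sigma_n$, acting on $L_n$ and on $K_n$ by permuting the variables. Then the following conditions are equivalent: (a) $L_n^S$ is rational over $K_n^S$; (b) $L_n^S$ is unirational over $K_n^S$; (c) $S$ has an orbit of odd order (cardinality) in $\{1,\dots,n\}$.
   Context: The group $\mathrm{PGL}_2$ (viewed as an algebraic group over $k$) acts on $L_n$ by applying the same fractional linear transformation to every variable: $\begin{pmatrix} a & b \\ c & d\end{pmatrix}\cdot x_i = \frac{a x_i + b}{c x_i + d}$ for $i=1,\dots,n$. The field of invariants $K_n = L_n^{\mathrm{PGL}_2}$ is the subfield of $L_n$ generated over $k$ by the $n-3$ cross-ratios $[x_1,x_2,x_3,x_i] = \frac{(x_i-x_1)(x_3-x_2)}{(x_i-x_2)(x_3-x_1)}$, $i=4,\dots,n$; it is called the field of cross-ratios. The symmetric group $\Sigma_n$ acts on $L_n$ by $k$-automorphisms permuting the variables, and this action restricts to a faithful action on $K_n$. $L_n^S$ and $K_n^S$ denote the fixed fields of $S$. A finitely generated field extension $E/F$ is rational if $E$ is purely transcendental over $F$, and unirational if $E$ embeds over $F$ into a purely transcendental extension of $F$ of finite transcendence degree. *)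

(* Defs.v *)
From HB Require Import structures.
From mathcomp Require Import all_boot all_order all_fingroup all_algebra.
From mathcomp Require Import boolp.
From mathcomp Require Import mpoly.

Set Implicit Arguments.
Unset Strict Implicit.
Unset Printing Implicit Defensive.

Import GRing.Theory.
Local Open Scope ring_scope.

Notation "x %:F" := (@FracField.tofrac _ x).

(* {fraction {mpoly F[r]}} is the field F(t_1, ..., t_r); a field extension
   E/F is given by its structure morphism iota : F -> E. *)
Definition ratfun_const (F : fieldType) (r : nat) (a : F) :
  {fraction {mpoly F[r]}} := (a%:MP)%:F.

(* The number r of generators is finite, so finite generation of E/F is part
   of both notions below. *)
Definition rational_ext (F E : fieldType) (iota : {rmorphism F -> E}) : Prop :=
  exists (r : nat) (phi : {rmorphism {fraction {mpoly F[r]}} -> E}),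
    bijective phi /\ (forall a : F, phi (ratfun_const r a) = iota a).

Definition unirational_ext (F E : fieldType) (iota : {rmorphism F -> E}) :
    Prop :=
  exists (r : nat) (phi : {rmorphism E -> {fraction {mpoly F[r]}}}),
    forall a : F, phi (iota a) = ratfun_const r a.

Fact pi_mul_denom (R : idomainType) (x : {ratio R}) :
  (\pi_({fraction R})%qT x : {fraction R}) * (\d_x)%:F = (\n_x)%:F.
Proof.
unlock FracField.tofrac; rewrite -[LHS]FracField.pi_mul.
apply/generic_quotient.eqmodP; rewrite /= FracField.equivfE /FracField.mulf.
by rewrite !numden_Ratio ?mulf_neq0 ?oner_eq0 ?denom_ratioP // !mulr1 mulrC.
Qed.

Section Subfield.
Variable L : fieldType.

Definition subfield (P : divringClosed L) := {x : L | x \in P}.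

HB.instance Definition _ (P : divringClosed L) := SubChoice.on (subfield P).
HB.instance Definition _ (P : divringClosed L) :=
  [SubChoice_isSubIntegralDomain of subfield P by <:].
HB.instance Definition _ (P : divringClosed L) :=
  [SubIntegralDomain_isSubField of subfield P by <:].

Section Inclusion.
Variables (P Q : divringClosed L) (sPQ : {subset P <= Q}).

Definition subfield_incl (x : subfield P) : subfield Q :=
  Sub (val x) (sPQ (valP x)).

Fact subfield_incl_is_zmod_morphism : zmod_morphism subfield_incl.
Proof. by move=> x y; exact: val_inj. Qed.

Fact subfield_incl_is_monoid_morphism : monoid_morphism subfield_incl.
Proof. by split=> [|x y]; apply: val_inj. Qed.

HB.instance Definition _ := GRing.isZmodMorphism.Build _ _ subfield_incl
  subfield_incl_is_zmod_morphism.
HB.instance Definition _ := GRing.isMonoidMorphism.Build _ _ subfield_incl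
  subfield_incl_is_monoid_morphism.
End Inclusion.

Definition generated_subfield (A : L -> Prop) : {pred L} :=
  fun x => `[< forall P : divringClosed L,
                 (forall a, A a -> a \in P) -> x \in P >].

Fact generated_subfield_closed (A : L -> Prop) :
  divring_closed (generated_subfield A).
Proof.
split=> [|x y /asboolP xA /asboolP yA|x y /asboolP xA /asboolP yA];
  apply/asboolP=> P AP; first exact: rpred1.
- by apply: rpredB; [apply: xA | apply: yA].
- by apply: rpred_div; [apply: xA | apply: yA].
Qed.

HB.instance Definition _ (A : L -> Prop) :=
  GRing.isDivringClosed.Build L (generated_subfield A)
    (generated_subfield_closed A).
End Subfield.

Section CrossRatios.
Variables (k : fieldType) (n : nat).

Local Notation Ln := {fraction {mpoly k[n]}}.

Definition Lx (i : 'I_n) : Ln := ('X_i)%:F.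

Local Notation frepr := generic_quotient.repr.

(* The result does not depend on the representative: perm_act_frac.
   msym s is the k-algebra endomorphism 'X_i |-> 'X_(s i) of {mpoly k[n]}. *)
Definition perm_act (s : 'S_n) (f : Ln) : Ln :=
  (msym s \n_(frepr f))%:F / (msym s \d_(frepr f))%:F.

Fact frac_numden (f : Ln) : f = (\n_(frepr f))%:F / (\d_(frepr f))%:F.
Proof.
have d0 : (\d_(frepr f))%:F != 0 :> Ln by rewrite tofrac_eq0 denom_ratioP.
apply: (mulIf d0); rewrite divfK //.
by rewrite -[RHS]pi_mul_denom generic_quotient.reprK.
Qed.

Fact msym_neq0 (s : 'S_n) (p : {mpoly k[n]}) : p != 0 -> msym s p != 0.
Proof.
by apply: contraNneq => e; apply/eqP/(@inj_msym n k s); rewrite e msym0.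
Qed.

Lemma perm_act_frac (s : 'S_n) (p q : {mpoly k[n]}) : q != 0 ->
  perm_act s (p%:F / q%:F) = (msym s p)%:F / (msym s q)%:F.
Proof.
move=> q0; rewrite /perm_act; set f := p%:F / q%:F.
have d0 : \d_(frepr f) != 0 by apply: denom_ratioP.
have /eqP := frac_numden f; rewrite {1}/f.
rewrite eqr_div ?tofrac_eq0 // -!tofracM tofrac_eq => /eqP e.
apply/eqP; rewrite eqr_div ?tofrac_eq0 ?msym_neq0 // -!tofracM tofrac_eq.
by rewrite -!msymM e.
Qed.

Lemma perm_act_Lx (s : 'S_n) (i : 'I_n) : perm_act s (Lx i) = Lx (s i).
Proof.
rewrite /Lx -[X in perm_act _ X]divr1 -tofrac1 perm_act_frac ?oner_eq0 //.
by rewrite msym1 tofrac1 divr1 /msym mmapX mmap1U.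
Qed.

Fact perm_act_is_zmod_morphism (s : 'S_n) : zmod_morphism (perm_act s).
Proof.
move=> f g; rewrite {1}(frac_numden f) {1}(frac_numden g) -mulNr.
have df : \d_(frepr f) != 0 by apply: denom_ratioP.
have dg : \d_(frepr g) != 0 by apply: denom_ratioP.
rewrite addf_div ?tofrac_eq0 // -tofracN -!tofracM -tofracD.
rewrite perm_act_frac ?mulf_neq0 // msymD !msymM msymN.
by rewrite tofracD !tofracM tofracN -addf_div ?tofrac_eq0 ?msym_neq0 // mulNr.
Qed.

Fact perm_act_is_monoid_morphism (s : 'S_n) : monoid_morphism (perm_act s).
Proof.
split=> [|f g].
  by rewrite -[X in perm_act _ X]divr1 -tofrac1 perm_act_frac ?oner_eq0 //
    msym1 tofrac1 divr1.
rewrite {1}(frac_numden f) {1}(frac_numden g) mulf_div -!tofracM.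
by rewrite perm_act_frac ?mulf_neq0 ?denom_ratioP // !msymM !tofracM -mulf_div.
Qed.

HB.instance Definition _ (s : 'S_n) :=
  GRing.isZmodMorphism.Build Ln Ln (perm_act s) (perm_act_is_zmod_morphism s).
HB.instance Definition _ (s : 'S_n) :=
  GRing.isMonoidMorphism.Build Ln Ln (perm_act s)
    (perm_act_is_monoid_morphism s).

Definition cross_ratio (a b c d : 'I_n) : Ln :=
  ((Lx d - Lx a) * (Lx c - Lx b)) / ((Lx d - Lx b) * (Lx c - Lx a)).

(* The variables are indexed from 0: the generators are the elements
   cross_ratio 0 1 2 i with 3 <= i < n. *)
Definition Kn_generator (f : Ln) : Prop :=
  (exists a : k, f = (a%:MP)%:F) \/
  (exists a b c i : 'I_n,
     [/\ a = 0%N :> nat, b = 1%N :> nat, c = 2%N :> nat, (3 <= i)%N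
       & f = cross_ratio a b c i]).

Definition Kn : divringClosed Ln := generated_subfield Kn_generator.

Variable S : {group 'S_n}.

Definition Ln_inv : {pred Ln} :=
  fun f => [forall s in S, perm_act s f == f].

Fact Ln_inv_closed : divring_closed Ln_inv.
Proof.
split=> [|f g /forall_inP fS /forall_inP gS|f g /forall_inP fS /forall_inP gS];
  apply/forall_inP=> s sS; first by rewrite rmorph1.
- by rewrite rmorphB /= (eqP (fS s sS)) (eqP (gS s sS)).
- by rewrite fmorph_div /= (eqP (fS s sS)) (eqP (gS s sS)).
Qed.

HB.instance Definition _ :=
  GRing.isDivringClosed.Build Ln Ln_inv Ln_inv_closed.

(* The action on Kn is the restriction of perm_act, so the fixed field of S in
   Kn is the intersection with the fixed field in the whole function field. *)
Definition Kn_inv : {pred Ln} := fun f => (f \in Kn) && (f \in Ln_inv).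

Fact Kn_inv_closed : divring_closed Kn_inv.
Proof.
split=> [|f g /andP[fK fS] /andP[gK gS]|f g /andP[fK fS] /andP[gK gS]];
  apply/andP; split.
- exact: rpred1.
- exact: rpred1.
- exact: rpredB.
- exact: rpredB.
- exact: rpred_div.
- exact: rpred_div.
Qed.

HB.instance Definition _ :=
  GRing.isDivringClosed.Build Ln Kn_inv Kn_inv_closed.

Fact Kn_inv_sub : {subset Kn_inv <= Ln_inv}.
Proof. by move=> f /andP[]. Qed.

Definition KnS : fieldType := subfield Kn_inv.
Definition LnS : fieldType := subfield Ln_inv.

Definition KnS_to_LnS : {rmorphism KnS -> LnS} := subfield_incl Kn_inv_sub.

End CrossRatios.

(* Main.v *)
Require Import Defs.
From mathcomp Require Import all_boot all_order all_fingroup all_algebra.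
From HB Require Import structures.
From mathcomp Require Import boolp.
From mathcomp Require Import mpoly ring zify.

(** Modulo cross-ratios the generic points x_i are the coordinates of a PGL_2-frame,
    so that L^S/K^S is the function field of a PGL_2-torsor, that is of a conic over
    K^S; everything hinges on whether this conic has a rational point.

    Write C (x_i - x_j) = n_ij e_i e_j with n_ij in K.  If O is an odd orbit with
    2l+1 elements and H = C^-(l+1) prod_(j in O) e_j, then s(H e_i) is H e_(s i) up to
    K for all s in S, so the K-space of affine forms a X + b with a x_i + b in K H e_i
    for all i is S-stable, of dimension 2.  By descent it has a basis of S-invariant
    forms p X + q, X + r (after scaling), and L^S = K^S(p, q, r).  The elements p, q, r
    are independent because x_i |-> T^-1 N x_i, with N the matrix of (p, q, r) and T a
    generic matrix, is an embedding of L over K that maps (p, q, r) to T.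

    Conversely a K^S-embedding of L^S in K^S(t) extends to an S-equivariant K-embedding
    psi of L in K(t).  The Moebius transformation taking x_i to psi(x_i) sends to
    infinity a point z of k(t)(x) that is fixed by S and, like the x_i, is mapped to
    lam / z by the automorphism x_i |-> lam / x_i, lam being one more indeterminate.
    Write z = P / Q in lowest terms and let d be the multidegree of the pair (P, Q).
    The two symmetries say that d is constant on the orbits of S and that
    lam^(|d| + 1) is a square; hence |d| is odd, and so is the size of some orbit. *)

Set Implicit Arguments.
Unset Strict Implicit.
Unset Printing Implicit Defensive.

Import GRing.Theory.
Local Open Scope ring_scope.

(** * Unique factorization in polynomial rings *)

Section Divisibility.
Variable R : idomainType.
Implicit Types a b c : R.

Definition divides a b := exists c, b = a * c.

Definition prime_elt a :=
  [/\ a != 0, a \isn't a GRing.unit &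
      forall b c, divides a (b * c) -> divides a b \/ divides a c].

Inductive prime_product : nat -> R -> Prop :=
| PPunit u : u \is a GRing.unit -> prime_product 0 u
| PPmul n p a : prime_elt p -> prime_product n a ->
    prime_product n.+1 (p * a).

(** Existence suffices here: the factors are prime, not merely irreducible, so uniqueness up to
    units follows. The count [n] is the measure of the inductions below. *)
Definition factorial_ring := forall a, a != 0 -> exists n, prime_product n a.

(* In a factorial ring this says that [a / b] is in lowest terms. *)
Definition lowest_terms a b :=
  b != 0 /\
  forall a' b', a * b' = a' * b -> exists c, a' = c * a /\ b' = c * b.

Lemma divides_mull a b c : divides a b -> divides a (c * b).
Proof. by case=> d ->; exists (c * d); rewrite mulrCA. Qed.

Lemma dividesD a b c : divides a b -> divides a c -> divides a (b + c).
Proof. by case=> d -> [e ->]; exists (d + e); rewrite mulrDr. Qed.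

Lemma dividesN a b : divides a b -> divides a (- b).
Proof. by case=> d ->; exists (- d); rewrite mulrN. Qed.

Lemma divides0 a : divides a 0.
Proof. by exists 0; rewrite mulr0. Qed.

Lemma prime_product_unit_mul n u a :
  u \is a GRing.unit -> prime_product n a -> prime_product n (u * a).
Proof.
move=> uU; elim=> [v vU|m p b pp _ IH]; first by apply: PPunit; rewrite unitrM uU.
by rewrite mulrCA; apply: PPmul.
Qed.

Lemma prime_product_mul m n a b :
  prime_product m a -> prime_product n b -> exists l, prime_product l (a * b).
Proof.
move=> Fa Fb; elim: Fa => [u uU|m' p c pp _ [l Fl]].
  by exists n; apply: prime_product_unit_mul.
by exists l.+1; rewrite -mulrA; apply: PPmul.
Qed.

(** Factors [q] are peeled off one at a time. If [p] divides [q], the two are associates because [q]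
    is prime as well; otherwise [p] divides the remaining product. *)
Lemma prime_product_div n a p b :
  prime_product n a -> prime_elt p -> a = p * b ->
  exists2 m, n = m.+1 & prime_product m b.
Proof.
move=> Fa pp; have [p0 pU pP] := pp.
elim: Fa b => [u uU b e|m q a' qq Fa' IH b e].
  by move: uU; rewrite e unitrM (negbTE pU).
have [q0 qU qP] := qq.
have [[c ec]|[c ec]] : divides p q \/ divides p a'.
  by apply: pP; exists b.
- have cU : c \is a GRing.unit.
    have [[d ed]|[d ed]] : divides q p \/ divides q c.
      by apply: qP; exists 1; rewrite mulr1 ec.
    + have : q * (d * c) = q * 1 by rewrite mulrA -ed -ec mulr1.
      by move/(mulfI q0)=> dc; apply/unitrPr; exists d; rewrite mulrC.
    + have : q * (p * d) = q * 1 by rewrite mulrCA -ed -ec mulr1.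
      move/(mulfI q0)=> pd; case/negP: pU.
      by apply/unitrPr; exists d.
  exists m => //; have -> : b = c * a'.
    by apply: (mulfI p0); rewrite -e {1}ec mulrA.
  exact: prime_product_unit_mul.
- have [m' -> Fc] := IH _ ec.
  exists m'.+1 => //; have -> : b = q * c.
    by apply: (mulfI p0); rewrite -e ec mulrCA.
  exact: PPmul.
Qed.

(** Induction on the number of primes in [b]. Common primes of [a] and [b] are removed; once none is
    left, the primes of [b] can be cancelled from [a * b' = a' * b]. *)
Lemma lowest_terms_exists a b : factorial_ring -> b != 0 ->
  exists a0 b0, a * b0 = a0 * b /\ lowest_terms a0 b0.
Proof.
move=> RF b0; have [n Fb] := RF b b0.
elim: n a b b0 Fb => [|n IH] a b b0 Fb.
  exists a, b; split=> //; split=> // a' b' e.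
  have bU : b \is a GRing.unit by inversion Fb.
  exists (b' / b); rewrite divrK //; split=> //.
  by apply: (mulIr bU); rewrite mulrAC divrK // -e mulrC.
have [[p [pp [a1 ea] [b1 eb]]]|noP] :=
    pselect (exists p, [/\ prime_elt p, divides p a & divides p b]).
  have [m [<-] Fb1] := prime_product_div Fb pp eb.
  have [p0 _ _] := pp.
  have b10 : b1 != 0 by apply: contraNneq b0 => h; rewrite eb h mulr0.
  have [a0 [b0' [e lt]]] := IH a1 b1 b10 Fb1.
  by exists a0, b0'; split=> //; rewrite ea eb -mulrA e mulrCA.
exists a, b; split=> //; split=> // a' b'.
(* Euclid's lemma for the divisors [d] of [b], which share no prime with [a]. *)
have H m d : prime_product m d -> divides d b -> forall x, divides d (a * x) ->
    divides d x.
  move=> Fd; elim: Fd => [u uU _ x _|m' p d' pp _ IHd [c ec] x [y ey]].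
    by exists (u^-1 * x); rewrite mulVKr.
  have [p0 _ pP] := pp.
  have [[t et]|[t et]] : divides p a \/ divides p x.
  - by apply: pP; exists (d' * y); rewrite mulrA.
  - by case: noP; exists p; split=> //; [exists t|exists (d' * c); rewrite mulrA].
  have [w ew] : divides d' t.
    apply: IHd; first by exists (p * c); rewrite ec; ring.
    by exists y; apply: (mulfI p0); rewrite mulrCA -et ey mulrA.
  by exists w; rewrite et ew mulrA.
move=> e; have [c ec] : divides b b'.
  by apply: (H _ _ Fb) => //; [exists 1; rewrite mulr1|exists a'; rewrite e mulrC].
exists c; split; last by rewrite ec mulrC.
by apply: (mulIf b0); rewrite -e ec; ring.
Qed.

Lemma field_factorial : (forall a, a != 0 -> a \is a GRing.unit) -> factorial_ring.
Proof. by move=> RU a /RU aU; exists 0%N; apply: PPunit. Qed.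

End Divisibility.

Lemma factorial_iso (R R' : idomainType) (f : {rmorphism R -> R'})
    (g : {rmorphism R' -> R}) :
  cancel f g -> cancel g f -> factorial_ring R -> factorial_ring R'.
Proof.
move=> fK gK RF a a0.
have [|n Fn] := RF (g a); first by rewrite (can2_eq gK fK) rmorph0.
exists n; rewrite -(gK a); elim: Fn => [u uU|m p b [p0 pU pP] _ IH].
  by apply: PPunit; apply: rmorph_unit.
rewrite rmorphM; apply: PPmul => //; split.
- by rewrite (can2_eq fK gK) rmorph0.
- by apply: contra pU => /(rmorph_unit g); rewrite fK.
- move=> x y [z e]; have [] := pP (g x) (g y).
  + by exists (g z); apply: (can_inj fK); rewrite !rmorphM /= !gK.
  + by case=> t et; left; exists (f t); rewrite -rmorphM -et gK.
  + by case=> t et; right; exists (f t); rewrite -rmorphM -et gK.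
Qed.

(** * Gauss's lemma and factoriality of polynomial rings *)

Section PolyFactorial.
Variable R : idomainType.
Implicit Types f g h : {poly R}.

Lemma divides_polyC (a : R) f : (forall i, divides a f`_i) -> divides a%:P f.
Proof.
move=> af; have [g ge] := choice af.
exists (\poly_(i < size f) g i); apply/polyP=> i; rewrite coefCM coef_poly.
by case: ltnP => [_|le]; rewrite ?mulr0 ?ge // -ge nth_default.
Qed.

Lemma first_nondivisible_coef (a : R) f : ~ divides a%:P f ->
  exists2 i, ~ divides a f`_i & forall j, (j < i)%N -> divides a f`_j.
Proof.
move=> af; have exi : exists i, `[< ~ divides a f`_i >].
  apply: contrapT => no; apply: af; apply: divides_polyC => i.
  by apply: contrapT => ni; apply: no; exists i; apply/asboolP.
exists (ex_minn exi); case: ex_minnP => i /asboolP // ni mi j lt.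
apply: contrapT => nj; have := mi j; rewrite leqNgt lt.
by case/(_ _)/negP => //; apply/asboolP.
Qed.

(** Gauss's lemma. If [f_i] and [g_j] are the first coefficients not divisible by [a], then all
    terms other than [f_i g_j] in the coefficient of index [i + j] of [f * g] are divisible by
    [a]. *)
Lemma prime_polyC (a : R) : prime_elt a -> prime_elt a%:P.
Proof.
move=> [a0 aU aP]; split; rewrite ?polyC_eq0 //.
  by rewrite poly_unitE coefC /= negb_and aU orbT.
move=> f g [h e]; apply: contrapT => /not_orP[af ag].
have [i nai mini] := first_nondivisible_coef af.
have [j naj minj] := first_nondivisible_coef ag.
have /(congr1 (fun p : {poly R} => p`_(i + j))) := e.
rewrite coefM coefCM (bigD1 (inord i)) //= !inordK ?ltnS ?leq_addr // addKn => e'.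
suff : divides a (f`_i * g`_j) by case/aP.
have -> : f`_i * g`_j = a * h`_(i + j) -
    \sum_(k < (i + j).+1 | k != inord i) f`_k * g`_(i + j - k).
  by rewrite -e' addrK.
apply: dividesD; first by exists h`_(i + j).
apply: dividesN; apply: big_ind => [||k ki]; [exact: divides0|exact: dividesD|].
case: (ltngtP k i) => [lt|lt|eq].
- by rewrite mulrC; apply: divides_mull; apply: mini.
- by apply: divides_mull; apply: minj; rewrite ltn_subLR ?ltn_add2r // -ltnS.
- by case/eqP: ki; apply: val_inj; rewrite /= inordK ?ltnS ?leq_addr.
Qed.

Definition primitive_poly f := forall p : R, prime_elt p -> ~ divides p%:P f.

(** The primes of [c] are cancelled one by one: each remains prime as a constant polynomial and does
    not divide [f], so it divides the cofactor [e]. *)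
Lemma primitive_cancel n (c : R) f (a e : {poly R}) :
  prime_product n c -> primitive_poly f -> c *: a = f * e -> divides f a.
Proof.
move=> Fc fP; elim: Fc a e => [u uU a e E|m p d pp _ IH a e E].
  by exists (u^-1 *: e); rewrite -scalerAr -E scalerA mulVr ?scale1r.
have [p0 _ _] := pp.
have [_ _ /(_ f e)[]] := prime_polyC pp.
- by exists (d *: a); rewrite -E mul_polyC scalerA.
- by move/fP; case.
- case=> e1 ee; apply: (IH a e1).
  apply: (mulfI (x := p%:P)); rewrite ?polyC_eq0 //.
  by rewrite mulrCA -ee -E mul_polyC scalerA.
Qed.

(** Each prime of [c] divides [g] or [h] and is taken out of that factor, which leaves the sizes
    unchanged. *)
Lemma scale_cancel n (c : R) f (g h : {poly R}) :
  prime_product n c -> c *: f = g * h ->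
  exists g' h', [/\ f = g' * h', size g' = size g & size h' = size h].
Proof.
move=> Fc; elim: Fc g h => [u uU g h E|m p d pp _ IH g h E].
  exists (u^-1 *: g), h; split=> //; last by rewrite size_scale ?invr_neq0 //;
    apply: contraTneq uU => ->; rewrite unitr0.
  by rewrite -scalerAl -E scalerA mulVr ?scale1r.
have [p0 _ _] := pp.
have pP0 : p%:P != 0 by rewrite polyC_eq0.
have [_ _ /(_ g h)[]] := prime_polyC pp.
- by exists (d *: f); rewrite -E mul_polyC scalerA.
- case=> g1 eg; have [|g' [h' [e sg sh]]] := IH g1 h.
    by apply: (mulfI pP0); rewrite mulrA -eg -E mul_polyC scalerA.
  by exists g', h'; rewrite e sg sh eg mul_polyC size_scale.
- case=> h1 eh; have [|g' [h' [e sg sh]]] := IH g h1.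
    by apply: (mulfI pP0); rewrite mulrCA -eh -E mul_polyC scalerA.
  by exists g', h'; rewrite e sg sh eh mul_polyC size_scale.
Qed.

(* Up to constants, i.e. in the sense of pseudo-division, [f] is irreducible:
   a Bezout relation then shows that it is prime. *)
Lemma primitive_irreducible_prime f : factorial_ring R ->
  (1 < size f)%N -> primitive_poly f ->
  (forall g h, f = g * h -> (size g <= 1)%N \/ (size h <= 1)%N) -> prime_elt f.
Proof.
move=> RF sf fP irr; have f0 : f != 0 by rewrite -size_poly_gt0 (ltn_trans _ sf).
split=> //; first by rewrite poly_unitE gtn_eqF.
have dvd2 (a : {poly R}) : (f %| a)%R -> divides f a.
  case/Pdiv.Idomain.dvdpP=> -[c e] /= c0 E; have [n Fc] := RF c c0.
  by apply: (primitive_cancel Fc fP (e := e)); rewrite E mulrC.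
move=> a b [c e].
have dvdab : (f %| a * b)%R by rewrite e; apply: dvdp_mulIl.
case: (boolP (coprimep f a)) => [/Gauss_dvdpr co|nco].
  by right; apply: dvd2; rewrite -(co b).
left; apply: dvd2.
(* The gcd divides [f] up to a constant, so the gcd or its cofactor is constant. A constant gcd
   contradicts [nco]; a constant cofactor makes [f] proportional to the gcd, hence a divisor of
   [a]. *)
have : (gcdp f a %| f)%R by apply: dvdp_gcdl.
case/Pdiv.Idomain.dvdpP=> -[d q] /= d0 E; have [n Fd] := RF d d0.
have [g [h [fgh sg sh]]] := scale_cancel Fd E.
have g0 : gcdp f a != 0 by rewrite gcdp_eq0 (negbTE f0).
case: (irr g h fgh) => [|].
- rewrite sg => /size1_polyC eq; rewrite eq mul_polyC in E.
  have q0 : q`_0 != 0.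
    apply: contraNneq f0 => h0; move: E.
    by rewrite h0 scale0r => /eqP; rewrite scale_poly_eq0 (negbTE d0).
  by rewrite -(dvdpZl _ _ d0) E dvdpZl // dvdp_gcdr.
- rewrite sh => sg1; case/negP: nco; rewrite coprimep_def eqn_leq sg1.
  by rewrite size_poly_gt0.
Qed.

(** Outer induction on the size. A primitive polynomial ([prim]) is constant, prime, or a product of
    two polynomials of smaller size; the general case is reduced to it by dividing out prime
    constants. *)
Lemma poly_factorial : factorial_ring R -> factorial_ring {poly R}.
Proof.
move=> RF f; have [N] := ubnP (size f); elim: N f => // N IHN f.
have {IHN} prim g : g != 0 -> (size g < N.+1)%N -> primitive_poly g ->
    exists n, prime_product n g.
  move=> g0 sgN gP.
  have {}IHN h : h != 0 -> (size h < size g)%N -> exists n, prime_product n h.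
    by move=> h0 lt; apply: IHN => //; apply: leq_trans lt sgN.
  case: (leqP (size g) 1) => [/size1_polyC eg|sg].
    have c0 : g`_0 != 0 by rewrite -polyC_eq0 -eg.
    have [n Fn] := RF _ c0.
    case: n _ / Fn eg => [u uU eg|n p a pp _ eg].
      by exists 0%N; rewrite eg; apply: PPunit; rewrite rmorph_unit.
    by case: (gP _ pp); exists a%:P; rewrite -polyCM.
  have [irr|] := pselect (forall a b, g = a * b ->
      (size a <= 1)%N \/ (size b <= 1)%N).
    exists 1%N; rewrite -[g]mulr1; apply: PPmul.
      exact: primitive_irreducible_prime.
    by apply: PPunit; rewrite unitr1.
  move=> /existsNP[a /existsNP[b /not_implyP[e /not_orP[/negP sa /negP sb]]]].
  rewrite -ltnNge in sa; rewrite -ltnNge in sb.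
  have a0 : a != 0 by rewrite -size_poly_gt0 (ltn_trans _ sa).
  have b0 : b != 0 by rewrite -size_poly_gt0 (ltn_trans _ sb).
  have sab : size g = (size a + size b).-1 by rewrite e size_mul.
  have [|m Fa] := IHN a a0; first by rewrite sab; lia.
  have [|n Fb] := IHN b b0; first by rewrite sab; lia.
  by rewrite e; apply: prime_product_mul Fa Fb.
move=> sfN f0; have [m Fm] : exists m, prime_product m (lead_coef f).
  by apply: RF; rewrite lead_coef_eq0.
(* A prime constant dividing [f] divides its leading coefficient, so dividing it out lowers the
   count [m]; for [m = 0] there is no such prime. *)
elim: m f f0 sfN Fm => [|m IHm] f f0 sfN Fm;
  (have [[p [pp [g e]]]|noP] :=
    pselect (exists p : R, prime_elt p /\ divides p%:P f);
    last by apply: prim => // p pp pf; apply: noP; exists p);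
  have [p0 _ _] := pp;
  have [m' em Fm'] := prime_product_div Fm pp (b := lead_coef g)
    ltac:(by rewrite e mul_polyC lead_coefZ); first by [].
have g0 : g != 0 by apply: contraNneq f0 => h; rewrite e h mulr0.
case: em Fm' => <- Fm'.
have [|n Fn] := IHm g g0 _ Fm'; first by move: sfN; rewrite e mul_polyC size_scale.
by exists n.+1; rewrite e; apply: PPmul => //; apply: prime_polyC.
Qed.
End PolyFactorial.

Lemma mpoly_rmorph_eq (n : nat) (R : nzRingType) (E : comNzRingType)
    (f g : {rmorphism {mpoly R[n]} -> E}) :
  (forall c, f c%:MP = g c%:MP) -> (forall i, f 'X_i = g 'X_i) -> f =1 g.
Proof.
move=> fgC fgX p; rewrite [p]mpolyE !rmorph_sum; apply: eq_bigr => m _.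
rewrite -mul_mpolyC !rmorphM /= fgC; congr (_ * _).
by rewrite mpolyXE_id !rmorph_prod; apply: eq_bigr => i _; rewrite !rmorphXn /= fgX.
Qed.

Lemma muni_widen (R : nzRingType) (n : nat) (i : 'I_n) :
  muni ('X_(widen_ord (leqnSn n) i) : {mpoly R[n.+1]}) = ('X_i)%:P.
Proof.
rewrite muniE msuppX big_seq1 mcoeffX eqxx scale1r mnm1E -val_eqE /=.
rewrite [_ == _](ltn_eqF (ltn_ord i)) expr0 -mul_polyC mulr1; congr (_%:P).
congr 'X_[_]; apply/mnmP=> j; rewrite mnmE !mnm1E -!val_eqE //=.
Qed.

Lemma muni_ord_max (R : nzRingType) (n : nat) :
  muni ('X_ord_max : {mpoly R[n.+1]}) = 'X.
Proof.
rewrite muniE msuppX big_seq1 mcoeffX eqxx scale1r mnm1E eqxx expr1 -mul_polyC.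
rewrite (_ : [multinom _ | _ < _] = 0%MM) ?mpolyX0 ?mul1r //.
apply/mnmP=> j; rewrite mnmE mnm1E mnm0E -val_eqE /=.
by rewrite [_ == _]gtn_eqF.
Qed.

(** [muni] singles out the last indeterminate as the variable of a univariate polynomial; its
    inverse is evaluation at ['X_ord_max]. Without indeterminates the ring is the field [F]. *)
Lemma mpoly_factorial (F : fieldType) (n : nat) : factorial_ring {mpoly F[n]}.
Proof.
elim: n => [|n IH].
  apply: field_factorial => p p0.
  have ep : p = (p@_0)%:MP.
    apply/mpolyP=> m; rewrite mcoeffC.
    have -> : m = 0%MM by apply/mnmP=> -[].
    by rewrite eqxx mulr1.
  rewrite ep rmorph_unit // unitfE; apply: contraNneq p0 => h.
  by rewrite ep h mpolyC0.
pose ev : {rmorphism {poly {mpoly F[n]}} -> {mpoly F[n.+1]}} :=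
  horner_morph (fun x => mulrC ('X_ord_max : {mpoly F[n.+1]}) (mwiden x)).
have evC c : ev c%:P = mwiden c by rewrite /ev /= horner_morphC.
have evX : ev 'X = 'X_ord_max by rewrite /ev /= horner_morphX.
pose mu : {rmorphism {mpoly F[n.+1]} -> {poly {mpoly F[n]}}} := @muni n F.
apply: (factorial_iso (f := ev) (g := mu)) (poly_factorial IH).
- have wid (c : {mpoly F[n]}) : mu (mwiden c) = c%:P.
    have E : mu \o @mwiden n F =1 polyC.
      apply: mpoly_rmorph_eq => [d|i] /=; first by rewrite mwidenC muniC.
      by rewrite mwidenX mnmwiden1 muni_widen.
    exact: E.
  move=> p; elim/poly_ind: p => [|p c IHp]; first by rewrite !rmorph0.
  by rewrite !rmorphD !rmorphM /= IHp evX evC muni_ord_max wid.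
- have E : ev \o mu =1 idfun.
    apply: mpoly_rmorph_eq => [d|i] /=; first by rewrite muniC evC mwidenC.
    case: (unliftP ord_max i) => [j ->|->]; last by rewrite muni_ord_max evX.
    have -> : lift ord_max j = widen_ord (leqnSn n) j.
      by apply: val_inj; rewrite /= /bump leqNgt ltn_ord.
    by rewrite muni_widen evC mwidenX mnmwiden1.
  exact: E.
Qed.

(** * Homomorphisms out of fields of rational functions *)

Section Fractions.
Variable R : idomainType.

Lemma fraction_quotient (f : {fraction R}) :
  exists p q : R, q != 0 /\ f = p%:F / q%:F.
Proof.
exists (\n_(generic_quotient.repr f)), (\d_(generic_quotient.repr f)).
have d0 := denom_ratioP (generic_quotient.repr f); split=> //.
have d0F : (\d_(generic_quotient.repr f))%:F != 0 :> {fraction R} by rewrite tofrac_eq0.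
by apply: (mulIf d0F); rewrite divfK // -[RHS]pi_mul_denom generic_quotient.reprK.
Qed.

Lemma fraction_rmorph_eq (E : fieldType) (f g : {rmorphism {fraction R} -> E}) :
  (forall x : R, f x%:F = g x%:F) -> f =1 g.
Proof.
by move=> fg x; have [p [q [q0 ->]]] := fraction_quotient x; rewrite !fmorph_div /= !fg.
Qed.

Section Lift.
Variables (E : fieldType) (h : {rmorphism R -> E}).
Hypothesis h_inj : forall x, h x = 0 -> x = 0.

Definition fraction_lift (f : {fraction R}) : E :=
  h \n_(generic_quotient.repr f) / h \d_(generic_quotient.repr f).

(** Independence of the representative: [h] preserves the cross-multiplied equality, and its
    injectivity keeps denominators nonzero. *)
Lemma fraction_lift_quotient p q : q != 0 -> fraction_lift (p%:F / q%:F) = h p / h q.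
Proof.
move=> q0; rewrite /fraction_lift; set f := p%:F / q%:F.
have hn0 x : x != 0 -> h x != 0 by apply: contraNneq => /h_inj ->.
have d0 := denom_ratioP (generic_quotient.repr f).
have d0F : (\d_(generic_quotient.repr f))%:F != 0 :> {fraction R} by rewrite tofrac_eq0.
have : f * (\d_(generic_quotient.repr f))%:F = (\n_(generic_quotient.repr f))%:F.
  by rewrite -pi_mul_denom generic_quotient.reprK.
have qF : q%:F != 0 :> {fraction R} by rewrite tofrac_eq0.
rewrite /f mulrAC => /(canRL (mulfVK qF)); rewrite -!tofracM => /eqP.
rewrite tofrac_eq => /eqP e.
by apply/eqP; rewrite eqr_div ?hn0 // -!rmorphM e mulrC.
Qed.

Fact fraction_lift_zmod_morphism : zmod_morphism fraction_lift.
Proof.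
move=> f g; have [p [q [q0 ->]]] := fraction_quotient f.
have [r [s [s0 ->]]] := fraction_quotient g.
have hn0 x : x != 0 -> h x != 0 by apply: contraNneq => /h_inj ->.
rewrite -mulNr addf_div ?tofrac_eq0 // -tofracN -!tofracM -tofracD.
rewrite !fraction_lift_quotient ?mulf_neq0 // rmorphD !rmorphM rmorphN.
by rewrite -addf_div ?hn0 // mulNr.
Qed.

Fact fraction_lift_monoid_morphism : monoid_morphism fraction_lift.
Proof.
split=> [|f g].
  rewrite -tofrac1 -[X in fraction_lift X]divr1 -tofrac1.
  by rewrite fraction_lift_quotient ?oner_eq0 // rmorph1 divr1.
have [p [q [q0 ->]]] := fraction_quotient f.
have [r [s [s0 ->]]] := fraction_quotient g.
by rewrite mulf_div -!tofracM !fraction_lift_quotient ?mulf_neq0 // !rmorphM mulf_div.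
Qed.

Lemma fraction_lift_exists :
  exists g : {rmorphism {fraction R} -> E}, forall x, g x%:F = h x.
Proof.
pose A := GRing.isZmodMorphism.Build _ _ fraction_lift fraction_lift_zmod_morphism.
pose B := GRing.isMonoidMorphism.Build _ _ fraction_lift fraction_lift_monoid_morphism.
pose g : {rmorphism {fraction R} -> E} := HB.pack fraction_lift A B.
exists g => x; rewrite -[x%:F]divr1 -tofrac1 [LHS]fraction_lift_quotient ?oner_eq0 //.
by rewrite rmorph1 divr1.
Qed.

End Lift.
End Fractions.

Lemma ratfun_lift_exists (n : nat) (F E : fieldType) (c : {rmorphism F -> E})
    (v : 'I_n -> E) : (forall p : {mpoly F[n]}, mmap c v p = 0 -> p = 0) ->
  exists g : {rmorphism {fraction {mpoly F[n]}} -> E},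
    (forall p : {mpoly F[n]}, g p%:F = mmap c v p) /\
    (forall a, g (ratfun_const n a) = c a) /\ (forall i, g ('X_i)%:F = v i).
Proof.
move=> inj; have [g ge] := fraction_lift_exists (h := mmap c v) inj.
exists g; split=> //; split=> [a|i]; rewrite ge /= ?mmapC //.
by rewrite mmapX mmap1U.
Qed.

Lemma ratfun_rmorph_eq (n : nat) (F E : fieldType)
    (f g : {rmorphism {fraction {mpoly F[n]}} -> E}) :
  (forall a, f (ratfun_const n a) = g (ratfun_const n a)) ->
  (forall i, f ('X_i)%:F = g ('X_i)%:F) -> f =1 g.
Proof.
move=> fgC fgX; apply: fraction_rmorph_eq => p.
have := @mpoly_rmorph_eq n F E (f \o @FracField.tofrac _) (g \o @FracField.tofrac _).
exact.
Qed.

(* Specializing the indeterminates of [L(T)] to the values [pt]: a polynomial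
   relation between the [u i / w i] survives. *)
Lemma specialize_independent (n m : nat) (F L : fieldType) (c : {rmorphism F -> L})
    (pt : 'I_m -> L) (u w : 'I_n -> {mpoly L[m]})
    (d : {rmorphism F -> {fraction {mpoly L[m]}}}) :
  (forall a, d a = ratfun_const m (c a)) ->
  (forall i, (w i).@[pt] != 0) ->
  (forall p : {mpoly F[n]}, mmap c (fun i => (u i).@[pt] / (w i).@[pt]) p = 0 ->
      p = 0) ->
  forall p : {mpoly F[n]}, mmap d (fun i => (u i)%:F / (w i)%:F) p = 0 -> p = 0.
Proof.
move=> dE w0 inj p; set xi := (fun i => _ / _); set v := (fun i => _ / _) in inj.
(* [spec f a] says that [f] is regular at [pt] with value [a]. This relation replaces the evaluation
   morphism on the local ring at [pt]. *)
pose spec (f : {fraction {mpoly L[m]}}) (a : L) := exists U V : {mpoly L[m]},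
  [/\ V.@[pt] != 0, f = U%:F / V%:F & a = U.@[pt] / V.@[pt]].
have nz (V : {mpoly L[m]}) : V.@[pt] != 0 -> V%:F != 0 :> {fraction {mpoly L[m]}}.
  by rewrite tofrac_eq0; apply: contraNneq => ->; rewrite meval0.
have specC a : spec (ratfun_const m a) a.
  exists a%:MP, 1; rewrite meval1 mevalC oner_neq0 tofrac1 !divr1; split=> //.
have specD f g a b : spec f a -> spec g b -> spec (f + g) (a + b).
  move=> [U [V [V0 -> ->]]] [U' [V' [V0' -> ->]]].
  exists (U * V' + U' * V), (V * V'); rewrite mevalM mulf_neq0 //; split=> //.
    by rewrite addf_div ?nz // tofracD !tofracM.
  by rewrite mevalD !mevalM addf_div.
have specM f g a b : spec f a -> spec g b -> spec (f * g) (a * b).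
  move=> [U [V [V0 -> ->]]] [U' [V' [V0' -> ->]]].
  exists (U * U'), (V * V'); rewrite mevalM mulf_neq0 //; split=> //.
    by rewrite mulf_div !tofracM.
  by rewrite !mevalM mulf_div.
have specX i : spec (xi i) (v i) by exists (u i), (w i).
have spec1 : spec 1 1.
  by have := specC 1; rewrite /ratfun_const mpolyC1 tofrac1.
have spec0 : spec 0 0.
  by have := specC 0; rewrite /ratfun_const mpolyC0 tofrac0.
have {}specM1 (r : seq 'I_n) (e : 'I_n -> nat) :
    spec (\prod_(i <- r) xi i ^+ e i) (\prod_(i <- r) v i ^+ e i).
  elim: r => [|i r IH]; first by rewrite !big_nil.
  rewrite !big_cons; apply: (specM) IH; elim: (e i) => [|k IHk]; first by rewrite !expr0.
  by rewrite !exprS; apply: specM.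
have specP : spec (mmap d xi p) (mmap c v p).
  rewrite /mmap; elim: (msupp p) => [|q r IH]; first by rewrite !big_nil.
  rewrite !big_cons; apply: (specD) IH; apply: (specM); last exact: specM1.
  by rewrite dE.
move=> p0; apply: inj; have [U [V [V0 e ->]]] := specP.
move/eqP: e; rewrite p0 eq_sym mulf_eq0 invr_eq0 (negbTE (nz _ V0)) orbF tofrac_eq0.
by move/eqP ->; rewrite meval0 mul0r.
Qed.

(** The generated subfield is an intersection of boolean [divringClosed] predicates; [P] is made
    boolean classically to become one of them. *)
Lemma generated_subfield_ind (L : fieldType) (A P : L -> Prop) :
  (forall a, A a -> P a) -> P 1 -> (forall a b, P a -> P b -> P (a - b)) ->
  (forall a b, P a -> P b -> P (a / b)) ->
  forall a, a \in generated_subfield A -> P a.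
Proof.
move=> AP P1 PB PD a /asboolP ga.
pose Q : {pred L} := fun x => `[< P x >].
have Qc : divring_closed Q.
  split=> [|x y /asboolP Px /asboolP Py|x y /asboolP Px /asboolP Py];
  apply/asboolP; [done|exact: PB|exact: PD].
pose Qm := GRing.isDivringClosed.Build L Q Qc.
pose QQ : divringClosed L := HB.pack Q Qm.
by apply/asboolP; apply: (ga QQ) => x /AP Px; apply/asboolP.
Qed.

Lemma mem_generated_subfield (L : fieldType) (A : L -> Prop) a :
  A a -> a \in generated_subfield A.
Proof. by move=> Aa; apply/asboolP => P; apply. Qed.

(** * Cross-ratios and the action of permutations *)

Section Action.
Variables (k : fieldType) (n : nat).
Local Notation Ln := {fraction {mpoly k[n]}}.
Local Notation x := (@Lx k n).

Lemma Lx_inj : injective x.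
Proof.
move=> i j /eqP; rewrite /Lx tofrac_eq => /eqP.
move/(congr1 (fun p => p.@[fun l => (l == i)%:R])); rewrite !mevalXU eqxx.
by case: eqP => // _ /eqP; rewrite oner_eq0.
Qed.

Lemma perm_act_const (s : 'S_n) (a : k) :
  perm_act s (ratfun_const n a) = ratfun_const n a.
Proof.
rewrite /ratfun_const -[X in perm_act s X]divr1 -tofrac1.
by rewrite perm_act_frac ?oner_eq0 // msym1 tofrac1 divr1 /msym mmapC.
Qed.

Lemma perm_actM (s t : 'S_n) (f : Ln) :
  perm_act (s * t)%g f = perm_act t (perm_act s f).
Proof.
apply: (ratfun_rmorph_eq (f := perm_act (s * t)%g)
  (g := perm_act t \o perm_act s)) => [a|i] /=.
  by rewrite !perm_act_const.
by rewrite -!/(Lx k _) !perm_act_Lx permM.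
Qed.

Lemma perm_act1 (f : Ln) : perm_act 1%g f = f.
Proof.
apply: (ratfun_rmorph_eq (f := perm_act 1%g) (g := idfun)) => [a|i] /=.
  by rewrite !perm_act_const.
by rewrite -!/(Lx k _) !perm_act_Lx perm1.
Qed.

Lemma Ln_generated (P : Ln -> Prop) :
  (forall a, P (ratfun_const n a)) -> (forall i, P (x i)) ->
  (forall f g, P f -> P g -> P (f - g)) ->
  (forall f g, P f -> P g -> P (f * g)) ->
  (forall f, P f -> P f^-1) -> forall f, P f.
Proof.
move=> PC PX PB PM PV f.
have P0 : P 0 by have := PC 0; rewrite /ratfun_const mpolyC0 tofrac0.
have P1 : P 1 by have := PC 1; rewrite /ratfun_const mpolyC1 tofrac1.
have PD g h : P g -> P h -> P (g + h).
  by move=> Pg Ph; rewrite -[h]opprK -[- h]add0r; apply: (PB) => //; apply: PB.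
suff pP (p : {mpoly k[n]}) : P p%:F.
  by have [p [q [_ ->]]] := fraction_quotient f; apply: (PM) => //; apply: PV.
rewrite [p]mpolyE rmorph_sum; apply: (big_ind P P0 PD) => m _.
rewrite -mul_mpolyC rmorphM /=; apply: (PM); first exact: PC.
rewrite mpolyXE_id rmorph_prod; apply: (big_ind P P1 PM) => i _; rewrite rmorphXn /=.
by elim: (m i) => [|l IH]; [rewrite expr0|rewrite exprS; apply: PM => //; apply: PX].
Qed.

End Action.

(** * Splitting the differences of the points modulo cross-ratios *)

Section Cocycle.
Variables (E : fieldType) (n : nat) (o0 o1 o2 : 'I_n) (x : 'I_n -> E).
Hypotheses (o01 : o0 != o1) (o02 : o0 != o2) (o12 : o1 != o2) (x_inj : injective x).

(* The difference [x i - x j] splits as a product up to [cr_coef i j], which is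
   a function of cross-ratios: see [cr_coef_spec] and [cr_coef_cross_ratio]. *)
Definition cr_const : E := (x o0 - x o1) * (x o2 - x o1) / (x o2 - x o0).
Definition cr_factor (i : 'I_n) : E := if i == o1 then cr_const else x i - x o1.
Definition cr_coef (i j : 'I_n) : E :=
  cr_const * (x i - x j) / (cr_factor i * cr_factor j).

Lemma sub_inj_neq0 i j : i != j -> x i - x j != 0.
Proof. by move=> ij; rewrite subr_eq0 (inj_eq x_inj). Qed.

Lemma cr_const_neq0 : cr_const != 0.
Proof. by rewrite !mulf_neq0 ?invr_eq0 ?sub_inj_neq0 // eq_sym. Qed.

Lemma cr_factor_neq0 i : cr_factor i != 0.
Proof.
rewrite /cr_factor; have [_|io] := eqVneq i o1; first exact: cr_const_neq0.
exact: sub_inj_neq0.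
Qed.

Lemma cr_coef_spec i j :
  cr_const * (x i - x j) = cr_coef i j * (cr_factor i * cr_factor j).
Proof. by rewrite /cr_coef divfK // mulf_neq0 ?cr_factor_neq0. Qed.

Lemma cr_coef_neq0 i j : i != j -> cr_coef i j != 0.
Proof.
move=> ij; apply: mulf_neq0.
  by rewrite mulf_neq0 ?cr_const_neq0 ?sub_inj_neq0.
by rewrite invr_eq0 mulf_neq0 ?cr_factor_neq0.
Qed.

(** [m] is the projective coordinate in which [x o0], [x o2] and [x o1] become [0], [1] and
    infinity. *)
Lemma cr_coef_cross_ratio i j :
  let m l := ((x l - x o0) * (x o2 - x o1)) / ((x l - x o1) * (x o2 - x o0)) in
  i != o1 -> j != o1 -> cr_coef i j = m i - m j.
Proof.
move=> m i1 j1.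
have h20 : x o2 - x o0 != 0 by rewrite sub_inj_neq0 // eq_sym.
have hi : x i - x o1 != 0 by rewrite sub_inj_neq0.
have hj : x j - x o1 != 0 by rewrite sub_inj_neq0.
rewrite /m /cr_coef /cr_factor /cr_const (negbTE i1) (negbTE j1).
by field; rewrite h20 hi hj.
Qed.

(** This normalization explains the special value of [cr_factor] at [o1], the index sent to
    infinity. *)
Lemma cr_coef_o1r i : i != o1 -> cr_coef i o1 = 1.
Proof.
move=> i1; rewrite /cr_coef /cr_factor eqxx (negbTE i1).
by field; rewrite sub_inj_neq0 // cr_const_neq0.
Qed.

Lemma cr_coefC i j : cr_coef j i = - cr_coef i j.
Proof. by rewrite /cr_coef -opprB mulrN mulNr [cr_factor j * _]mulrC. Qed.

(** Each point occurs once above and once below in a cross-ratio, so the factors and the constant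
    cancel. Hence all cross-ratios, not only the generators, lie in the field of cross-ratios. *)
Lemma cr_coef_quotient a b c e : a != c -> b != e ->
  ((x e - x a) * (x c - x b)) / ((x e - x b) * (x c - x a)) =
  cr_coef e a * cr_coef c b / (cr_coef e b * cr_coef c a).
Proof.
move=> ac be.
have h i j : x i - x j = cr_coef i j * (cr_factor i * cr_factor j) / cr_const.
  by rewrite -cr_coef_spec mulrC mulKf ?cr_const_neq0.
have ca : cr_coef c a != 0 by rewrite cr_coef_neq0 // eq_sym.
have eb : cr_coef e b != 0 by rewrite cr_coef_neq0 // eq_sym.
have := (cr_factor_neq0 a, cr_factor_neq0 b, cr_factor_neq0 c, cr_factor_neq0 e).
move=> [[[fa fb] fc] fe]; have c0 := cr_const_neq0.
rewrite !h; move: (cr_coef _ _) ca => nca ca; move: (cr_coef e b) eb => neb eb.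
move: (cr_factor _) (cr_factor _) (cr_factor _) (cr_factor _) fa fb fc fe => fa fb fc fe *.
by field; do ?[apply/andP; split].
Qed.

End Cocycle.

Lemma three_more_ord (n : nat) (a b : 'I_n) : (5 <= n)%N ->
  exists c d e, [/\ uniq [:: a; c; d; e], c != b, d != b & e != b].
Proof.
move=> n5; pose r := filter (predC (pred2 a b)) (enum 'I_n).
have ru : uniq r by rewrite filter_uniq // enum_uniq.
have rm i : i \in r -> (i != a) /\ (i != b).
  by rewrite mem_filter /= negb_or => /andP[/andP[]].
have rs : (3 <= size r)%N.
  have cn := count_predC (pred2 a b) (enum 'I_n).
  have c2 : (count (pred2 a b) (enum 'I_n) <= size [:: a; b])%N.
    rewrite -size_filter; apply: uniq_leq_size; first by rewrite filter_uniq // enum_uniq.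
    by move=> i; rewrite mem_filter !inE => /andP[].
  by rewrite size_filter; move: cn c2; rewrite size_enum_ord /=; lia.
have m i : (i < 3)%N -> nth a r i \in r by move=> i3; rewrite mem_nth // (leq_trans i3).
have ne i j : (i < 3)%N -> (j < 3)%N -> i != j -> nth a r i != nth a r j.
  by move=> i3 j3 ij; rewrite nth_uniq // (leq_trans _ rs).
exists (nth a r 0), (nth a r 1), (nth a r 2); split;
  [|by case: (rm _ (m 0 isT))|by case: (rm _ (m 1 isT))|by case: (rm _ (m 2 isT))].
have [[a0 _] [a1 _] [a2 _]] := And3 (rm _ (m 0 isT)) (rm _ (m 1 isT)) (rm _ (m 2 isT)).
by rewrite /= !inE !negb_or ![a == _]eq_sym a0 a1 a2 !ne.
Qed.

Section CrossRatioField.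
Variables (k : fieldType) (n : nat) (o0 o1 o2 : 'I_n).
Hypotheses (o0E : o0 = 0%N :> nat) (o1E : o1 = 1%N :> nat) (o2E : o2 = 2%N :> nat).
Local Notation Ln := {fraction {mpoly k[n]}}.
Local Notation K := (Kn k n).
Local Notation x := (@Lx k n).

Let o01 : o0 != o1. Proof. by rewrite -val_eqE /= o0E o1E. Qed.
Let o02 : o0 != o2. Proof. by rewrite -val_eqE /= o0E o2E. Qed.
Let o12 : o1 != o2. Proof. by rewrite -val_eqE /= o1E o2E. Qed.

Lemma ratfun_const_in_Kn (a : k) : ratfun_const n a \in K.
Proof. by apply: mem_generated_subfield; left; exists a. Qed.

Lemma cr_coef_in_Kn i j : cr_coef o0 o1 o2 x i j \in K.
Proof.
(* For [l >= 3] this is a generator of [K]; at [o0] it is [0] and at [o2] it is [1]. *)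
have mK l : l != o1 ->
    ((x l - x o0) * (x o2 - x o1)) / ((x l - x o1) * (x o2 - x o0)) \in K.
  move=> l1; case: (ltnP l 3) => [l3|l3]; last first.
    by apply: mem_generated_subfield; right; exists o0, o1, o2, l.
  have [->|l0] := eqVneq l o0; first by rewrite subrr !mul0r rpred0.
  have -> : l = o2.
    by apply: val_inj; move: l0 l1 l3; rewrite -!val_eqE /= o0E o1E o2E; lia.
  rewrite [X in X / _]mulrC divff ?rpred1 // mulf_neq0 // (sub_inj_neq0 (@Lx_inj k n)) //.
    by rewrite eq_sym.
  by rewrite eq_sym.
have [->|i1] := eqVneq i o1; last first.
  have [->|j1] := eqVneq j o1.
    by rewrite cr_coef_o1r ?rpred1 //; exact: Lx_inj.
  by rewrite cr_coef_cross_ratio ?rpredB ?mK //; exact: Lx_inj.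
have [->|j1] := eqVneq j o1.
  by rewrite /cr_coef subrr mulr0 mul0r rpred0.
by rewrite cr_coefC cr_coef_o1r ?rpredN ?rpred1 //; exact: Lx_inj.
Qed.

Lemma cross_ratio_in_Kn a b c e : a != c -> b != e -> cross_ratio k a b c e \in K.
Proof.
move=> ac be; have xi := @Lx_inj k n.
rewrite /cross_ratio (cr_coef_quotient o01 o02 o12 xi) //.
by rewrite rpred_div // rpredM // cr_coef_in_Kn.
Qed.

Lemma perm_act_Kn s f : f \in K -> perm_act s f \in K.
Proof.
apply: (generated_subfield_ind (P := fun f => perm_act s f \in K)) f
  => [f [[a ->]|]| |f g fK gK|f g fK gK].
- by rewrite perm_act_const ratfun_const_in_Kn.
- case=> [a [b [c [i [a0 b1 c2 i3 ->]]]]].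
  rewrite /cross_ratio fmorph_div !rmorphM !rmorphB /= !perm_act_Lx.
  by apply: cross_ratio_in_Kn; rewrite (inj_eq perm_inj) -val_eqE /=; lia.
- by rewrite rmorph1 rpred1.
- rewrite rmorphB /=. apply: rpredB. exact: fK. exact: gK.
- rewrite fmorph_div. apply: rpred_div. exact: fK. exact: gK.
Qed.

(** An index [a] moved by [s] is completed to a cross-ratio avoiding [s a], whose image does depend
    on the variable of index [s a]. Three indices outside [a] and [s a] are required, whence
    [5 <= n]. *)
Lemma Kn_faithful (s : 'S_n) : (5 <= n)%N -> s != 1%g ->
  exists2 f, f \in K & perm_act s f != f.
Proof.
move=> n5 s1; have [a sa] : exists a, s a != a.
  apply: contrapT => no; case/eqP: s1; apply/permP => i; rewrite perm1.
  by apply: contrapT => /eqP si; apply: no; exists i.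
have [c [e [g [uq cb eb gb]]]] := three_more_ord a (s a) n5.
move: uq; rewrite /= !inE !negb_or => /and4P[/and3P[ac ae ag] /andP[ce cg] eg _].
have gc : g != c by rewrite eq_sym.
have ga : g != a by rewrite eq_sym.
exists (cross_ratio k a c e g); first exact: cross_ratio_in_Kn.
have sne i : i != a -> s i != s a by move=> ia; rewrite (inj_eq perm_inj).
have D0 i j : i != j -> x i - x j != 0 by apply: sub_inj_neq0; exact: Lx_inj.
rewrite /cross_ratio fmorph_div !rmorphM !rmorphB /= !perm_act_Lx.
rewrite eqr_div; try (apply: mulf_neq0; apply: D0); rewrite ?(inj_eq perm_inj) //;
  try by rewrite eq_sym.
rewrite -!tofracB -!tofracM tofrac_eq.
(* Substituting [X_(s g)] for [X_(s a)] kills the left-hand side only. *)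
pose phi : {rmorphism {mpoly k[n]} -> {mpoly k[n]}} :=
  mmap (@mpolyC n k) (fun i => if i == s a then 'X_(s g) else 'X_i).
have phiE i : i != s a -> phi 'X_i = 'X_i.
  by move=> h; rewrite /phi /= mmapX mmap1U (negbTE h).
have phib : phi 'X_(s a) = 'X_(s g) by rewrite /phi /= mmapX mmap1U eqxx.
have P0 i j : i != j -> 'X_i - 'X_j != 0 :> {mpoly k[n]}.
  by move=> ij; rewrite -tofrac_eq0 tofracB; apply: D0.
apply/negP => /eqP /(congr1 phi).
rewrite !rmorphM !rmorphB /= phib !phiE ?sne //; try by rewrite eq_sym.
rewrite subrr !(mul0r, mulr0) => /eqP.
apply/negP; rewrite eq_sym.
by do !apply: mulf_neq0; apply: P0; rewrite ?(inj_eq perm_inj) // eq_sym.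
Qed.
End CrossRatioField.

(** * Galois descent *)

Section GaloisDescent.
Variables (L : fieldType) (gT : finGroupType) (S : {group gT}).
Variable act : gT -> {rmorphism L -> L}.
Hypothesis act1 : forall f, act 1%g f = f.
Hypothesis actM : forall s t f, act (s * t)%g f = act t (act s f).
Variable K : divringClosed L.
Hypothesis actK : forall s f, f \in K -> act s f \in K.
Hypothesis act_faithful :
  forall s, s \in S -> s != 1%g -> exists2 f, f \in K & act s f != f.

Definition trace (f : L) : L := \sum_(s in S) act s f.
Definition invariant_elt (f : L) : Prop := forall s, s \in S -> act s f = f.

Lemma trace_invariant f : invariant_elt (trace f).
Proof.
move=> s sS; rewrite /trace rmorph_sum [RHS](reindex_inj (mulIg s)).
by apply: eq_big => [t|t _]; rewrite ?groupMr // actM.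
Qed.

Lemma trace_in_K f : f \in K -> trace f \in K.
Proof. by move=> fK; apply: rpred_sum => s _; apply: actK. Qed.

Lemma traceD f g : trace (f + g) = trace f + trace g.
Proof. by rewrite -big_split; apply: eq_bigr => s _; rewrite rmorphD. Qed.

Lemma traceB f g : trace (f - g) = trace f - trace g.
Proof.
rewrite traceD; congr (_ + _); rewrite -sumrN.
by apply: eq_bigr => s _; rewrite rmorphN.
Qed.

Lemma trace_linear c f : invariant_elt c -> trace (c * f) = c * trace f.
Proof.
by move=> ci; rewrite mulr_sumr; apply: eq_bigr => s sS; rewrite rmorphM /= ci.
Qed.

(** A family that replaces a pair of dual bases of [K] over its fixed field: the [p.1] generate, and
    the coordinates are [trace (p.2 * f)], by [dual_family_expand]. It serves for [L] over its fixed
    field as well. *)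
Definition dual_family (E : seq (L * L)) : Prop :=
  (forall p, p \in E -> p.1 \in K /\ p.2 \in K) /\
  (forall s, s \in S -> \sum_(p <- E) p.1 * act s p.2 = (s == 1%g)%:R).

(* The element [sum p.1 (x) p.2] of the tensor square is built as a product over
   [u != 1] of factors that are [1] at the identity and [0] at [u]. *)
Lemma dual_family_exists : exists E, dual_family E.
Proof.
suff H (A : seq gT) : all (fun s => (s \in S) && (s != 1%g)) A ->
    exists E : seq (L * L), (forall p, p \in E -> p.1 \in K /\ p.2 \in K) /\
      (forall s, s \in 1%g :: A -> \sum_(p <- E) p.1 * act s p.2 = (s == 1%g)%:R).
  have [|E [EK ES]] := H (enum (S :\ 1%g)).
    by apply/allP => s; rewrite mem_enum !inE andbC.
  exists E; split=> // s sS; apply: ES; rewrite inE mem_enum !inE sS andbT.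
  by case: eqP.
elim: A => [_|u A IH /= /andP[/andP[uS u1] /IH [E [EK ES]]]].
  exists [:: (1, 1)]; split=> [p|s]; rewrite inE => /eqP ->; first by rewrite /= !rpred1.
  by rewrite big_seq1 /= act1 mulr1 eqxx.
have [||a aK a1] := act_faithful (s := u^-1%g); rewrite ?groupV ?invg_eq1 //.
(* As [act u b = a], the factor [(a - act s b) / (a - b)] is [1] at [s = 1] and [0] at [s = u]. *)
set b := act u^-1%g a in a1; have bK : b \in K by apply: actK.
have ab0 : a - b != 0 by rewrite subr_eq0 eq_sym.
have iK : (a - b)^-1 \in K by rewrite rpredV rpredB.
exists (map (fun p => (p.1 * (a / (a - b)), p.2)) E ++
   map (fun p => (- (p.1 / (a - b)), p.2 * b)) E); split.
  move=> p; rewrite mem_cat => /orP[] /mapP[q /EK [q1 q2] ->] /=; split=> //.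
  - by rewrite rpredM // rpredM.
  - by rewrite rpredN rpredM.
  - by rewrite rpredM.
move=> s; rewrite inE => sA; rewrite big_cat !big_map /=.
have -> : \sum_(p <- E) p.1 * (a / (a - b)) * act s p.2 +
    \sum_(p <- E) - (p.1 / (a - b)) * act s (p.2 * b) =
    (\sum_(p <- E) p.1 * act s p.2) * ((a - act s b) / (a - b)).
  rewrite mulr_suml -big_split; apply: eq_bigr => p _ /=; rewrite rmorphM /=; ring.
have [->|us] := eqVneq s u.
  by rewrite (negbTE u1) /b -actM mulVg act1 subrr mul0r mulr0.
have [s1|s1] := eqVneq s 1%g.
  by rewrite ES ?s1 ?inE ?eqxx // act1 mul1r divff.
case/or3P: sA => [/eqP e|/eqP e|sA].
- by rewrite e eqxx in s1.
- by rewrite e eqxx in us.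
- by rewrite ES; [rewrite (negbTE s1) mul0r|rewrite inE; apply/orP; right; exact: sA].
Qed.

Section WithDualFamily.
Variable E : seq (L * L).
Hypothesis EP : dual_family E.

Lemma dual_family_expand f : \sum_(p <- E) trace (p.2 * f) * p.1 = f.
Proof.
have [_ ES] := EP.
transitivity (\sum_(s in S) (\sum_(p <- E) p.1 * act s p.2) * act s f).
  rewrite /trace; under eq_bigr do rewrite mulr_suml; rewrite exchange_big /=.
  apply: eq_bigr => s _; rewrite mulr_suml; apply: eq_bigr => p _.
  by rewrite rmorphM /=; ring.
rewrite (bigD1 1%g) ?group1 //= ES ?group1 // eqxx mul1r act1 big1 ?addr0 //.
by move=> s /andP[sS s1]; rewrite ES // (negbTE s1) mul0r.
Qed.

(** If the trace vanished on [K], the expansion of [1] in the dual family would be [0]; a nonzero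
    trace is then scaled to [1]. *)
Lemma trace1_exists : exists2 e, e \in K & trace e = 1.
Proof.
have [EK _] := EP.
have [[e eK e0]|no] := pselect (exists2 e, e \in K & trace e != 0).
  exists ((trace e)^-1 * e); first by rewrite rpredM // rpredV trace_in_K.
  rewrite trace_linear ?mulVf // => s sS.
  by rewrite fmorphV trace_invariant.
have := dual_family_expand 1; rewrite big_seq big1 => [/eqP|p /EK [_ pK]].
  by rewrite eq_sym oner_eq0.
have -> : trace (p.2 * 1) = 0; last by rewrite mul0r.
by apply: contrapT => /eqP h; apply: no; exists (p.2 * 1); rewrite ?mulr1 // -[p.2]mulr1.
Qed.

Variables (W : fieldType) (j : {rmorphism L -> W}) (chi : L -> W).
Hypothesis chiB :
  forall f g, invariant_elt f -> invariant_elt g -> chi (f - g) = chi f - chi g.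
Hypothesis chiM :
  forall f g, invariant_elt f -> invariant_elt g -> chi (f * g) = chi f * chi g.
Hypothesis chiK : forall f, invariant_elt f -> f \in K -> chi f = j f.

(** This is the map induced by [chi] and [j] on [L], seen as the tensor product of the fixed field
    of [L] with [K] over the fixed field of [K]; [f] is written through its expansion in the dual
    family. *)
Definition descent_extension (f : L) : W :=
  \sum_(p <- E) chi (trace (p.2 * f)) * j p.1.
Local Notation psi := descent_extension.

Lemma descent_extension_zmod_morphism : zmod_morphism psi.
Proof.
move=> f g; rewrite /psi -sumrB; apply: eq_bigr => p _.
by rewrite mulrBr traceB chiB ?mulrBl //; apply: trace_invariant.
Qed.

#[local] HB.instance Definition _ := GRing.isZmodMorphism.Build _ _ psi
  descent_extension_zmod_morphism.

Lemma descent_extension_K a : a \in K -> psi a = j a.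
Proof.
move=> aK; have [EK _] := EP.
rewrite -[in RHS](dual_family_expand a) rmorph_sum /psi big_seq [RHS]big_seq.
apply: eq_bigr => p /EK [_ pK]; rewrite chiK ?rmorphM //; first exact: trace_invariant.
by apply: trace_in_K; apply: rpredM.
Qed.

Lemma descent_extension_linear g f : invariant_elt g -> psi (g * f) = chi g * psi f.
Proof.
move=> gi; rewrite /psi mulr_sumr; apply: eq_bigr => p _.
have -> : p.2 * (g * f) = g * (p.2 * f) by ring.
by rewrite trace_linear // chiM ?mulrA //; apply: trace_invariant.
Qed.

Lemma descent_extension_mulK f a : a \in K -> psi (f * a) = psi f * j a.
Proof.
move=> aK; have [EK _] := EP.
rewrite -{1}(dual_family_expand f) mulr_suml raddf_sum /= {2}/psi mulr_suml.
rewrite big_seq [RHS]big_seq; apply: eq_bigr => p /EK [pK _].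
rewrite -!mulrA (descent_extension_linear _ (trace_invariant _)).
by rewrite descent_extension_K ?rpredM // rmorphM.
Qed.

Lemma descent_extension_monoid_morphism : monoid_morphism psi.
Proof.
split=> [|f g]; first by rewrite descent_extension_K ?rpred1 // rmorph1.
have [EK _] := EP.
rewrite -{1}(dual_family_expand f) mulr_suml raddf_sum /= {2}/psi mulr_suml.
rewrite big_seq [RHS]big_seq; apply: eq_bigr => p /EK [pK _].
rewrite -!mulrA (descent_extension_linear _ (trace_invariant _)).
by rewrite [p.1 * g]mulrC descent_extension_mulK // [_ * j _]mulrC.
Qed.

Lemma descent_extension_equivariant s (tau : {rmorphism W -> W}) : s \in S ->
  (forall f, invariant_elt f -> tau (chi f) = chi f) ->
  (forall a, a \in K -> tau (j a) = j (act s a)) ->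
  forall f, tau (psi f) = psi (act s f).
Proof.
move=> sS tchi tj f; have [EK _] := EP.
rewrite -[in RHS](dual_family_expand f) (rmorph_sum (act s)).
rewrite [RHS]raddf_sum /= [LHS]rmorph_sum.
rewrite big_seq [RHS]big_seq; apply: eq_bigr => p /EK [pK _].
rewrite !rmorphM /= (trace_invariant _ sS).
rewrite (descent_extension_linear _ (trace_invariant _)) descent_extension_K ?actK //.
by rewrite tchi ?tj //; apply: trace_invariant.
Qed.

End WithDualFamily.

(** [tau] is arbitrary so that equivariance applies both to the permutations of the variables of [W]
    and, with [s = 1], to the inversion [x_i |-> lam / x_i]. *)
Lemma descent_extension_exists (W : fieldType) (j : {rmorphism L -> W}) (chi : L -> W) :
  (forall f g, invariant_elt f -> invariant_elt g -> chi (f - g) = chi f - chi g) ->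
  (forall f g, invariant_elt f -> invariant_elt g -> chi (f * g) = chi f * chi g) ->
  (forall f, invariant_elt f -> f \in K -> chi f = j f) ->
  exists psi : {rmorphism L -> W}, (forall a, a \in K -> psi a = j a) /\
    forall s (tau : {rmorphism W -> W}), s \in S ->
      (forall f, invariant_elt f -> tau (chi f) = chi f) ->
      (forall a, a \in K -> tau (j a) = j (act s a)) ->
      forall f, tau (psi f) = psi (act s f).
Proof.
move=> chiB chiM chiK; have [E EP] := dual_family_exists.
pose A := GRing.isZmodMorphism.Build _ _ _ (descent_extension_zmod_morphism E j chiB).
pose B := GRing.isMonoidMorphism.Build _ _ _
  (descent_extension_monoid_morphism EP chiB chiM chiK).
pose psi : {rmorphism L -> W} := HB.pack (descent_extension E j chi) A B.
exists psi; split; first exact: descent_extension_K.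
by move=> s tau sS tchi tj f; apply: (descent_extension_equivariant EP).
Qed.

End GaloisDescent.

(** * Covariant points have odd multidegree *)

Lemma sum_uniq_pred1 (I : eqType) (V : nmodType) (r : seq I) (i : I) (v : V) :
  uniq r -> \sum_(j <- r) (if j == i then v else 0) = if i \in r then v else 0.
Proof.
move=> ru; rewrite -big_mkcond -big_filter.
have [ir|ir] := boolP (i \in r); first by rewrite filter_pred1_uniq // big_seq1.
rewrite big_filter big1_seq // => j /andP[/eqP -> jr].
by rewrite jr in ir.
Qed.

(** * Degree in one variable *)

Section PartialDegree.
Variables (F : fieldType) (n : nat) (i : 'I_n).
Implicit Types p q : {mpoly F[n]}.

(** A new variable marks the powers of ['X_i] without removing them, so the coefficient of index [a]
    is the part of [p] of degree [a] in ['X_i]. *)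
Definition single_out : {rmorphism {mpoly F[n]} -> {poly {mpoly F[n]}}} :=
  mmap (polyC \o @mpolyC n F) (fun j => ('X_j)%:P * 'X^(j == i)).

Lemma mcoeff_single_out p a (m : 'X_{1..n}) :
  (single_out p)`_a@_m = if m i == a then p@_m else 0.
Proof.
have mon (u : 'X_{1..n}) :
    mmap1 (fun j => ('X_j)%:P * 'X^(j == i)) u = ('X_[u] : {mpoly F[n]})%:P * 'X^(u i).
  rewrite /mmap1 mpolyXE_id rmorph_prod -[X in _ = _ * X]mul1r.
  rewrite (_ : 'X^(u i) = \prod_j ('X^(j == i)) ^+ u j :> {poly {mpoly F[n]}}).
    by rewrite mul1r -big_split; apply: eq_bigr => j _; rewrite exprMn rmorphXn.
  rewrite (bigD1 i) //= eqxx expr1 big1 ?mulr1 // => j /negbTE ->.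
  by rewrite expr0 expr1n.
rewrite /single_out /= /mmap coef_sum raddf_sum /=.
rewrite (eq_bigr (fun u => if u == m then (if m i == a then p@_m else 0) else 0)).
  rewrite sum_uniq_pred1 // mcoeff_msupp.
  by case: eqP => //= ->; case: ifP.
move=> u _; rewrite mon mulrA -polyCM coefCM coefXn mul_mpolyC.
rewrite mulr_natr mcoeffMn mcoeffZ mcoeffX.
have [->|um] := eqVneq u m; last by rewrite mulr0 mul0rn.
by rewrite mulr1 eq_sym; case: eqP.
Qed.

Lemma size_single_out p N :
  reflect (forall m, m \in msupp p -> (m i <= N)%N) (size (single_out p) <= N.+1)%N.
Proof.
apply: (iffP (leq_sizeP _ _)) => [H m|H a Na].
  rewrite mcoeff_msupp leqNgt; apply: contraNN => lt.
  have := mcoeff_single_out p (m i) m; rewrite eqxx H //.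
  by rewrite mcoeff0 => <-.
apply/mpolyP => m; rewrite mcoeff_single_out mcoeff0; case: eqP => // ea.
apply/eqP; rewrite mcoeff_eq0; apply/negP => /H; lia.
Qed.

(** The degree in ['X_i] is additive: it is the degree of the image under [single_out], over an
    integral domain. *)
Lemma partial_degree_mul c p N : c != 0 ->
  (forall m, m \in msupp (c * p) -> (m i <= N)%N) ->
  (exists2 m, m \in msupp p & m i = N) ->
  forall m, m \in msupp c -> m i = 0%N.
Proof.
move=> c0 /size_single_out cpN [m mp mN] u uc; apply/eqP; rewrite -leqn0.
move: u uc; apply/size_single_out.
have p0 : p != 0 by apply: contraTneq mp => ->; rewrite msupp0.
have s0 q : q != 0 -> single_out q != 0.
  move=> q0; rewrite -size_poly_gt0; case: posnP => // /eqP.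
  rewrite size_poly_eq0 => /eqP sq0; case/eqP: q0; apply/mpolyP => v.
  by have := mcoeff_single_out q (v i) v; rewrite eqxx sq0 coef0 mcoeff0 => ->.
have sp : (N < size (single_out p))%N.
  rewrite ltnNge; apply/negP; case: N mN {cpN} => [|N] mN.
    by rewrite leqn0 size_poly_eq0 (negbTE (s0 _ p0)).
  by move/size_single_out/(_ m mp); rewrite mN ltnn.
have ar a b : (N < a)%N -> ((b + a).-1 <= N.+1)%N -> (b <= 1)%N by clear; lia.
apply: (ar _ _ sp); move: cpN; rewrite rmorphM size_mul //; exact: s0.
Qed.

Lemma mpoly_const_of_partial_degree (c : {mpoly F[n]}) :
  (forall m, m \in msupp c -> m = 0%MM) -> c = (c@_0)%:MP.
Proof.
move=> H; apply/mpolyP => m; rewrite mcoeffC.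
have [->|m0] := eqVneq m 0%MM; first by rewrite mulr1.
rewrite mulr0; apply/eqP; rewrite mcoeff_eq0.
by apply/negP => /H /eqP; rewrite (negbTE m0).
Qed.

End PartialDegree.

(** * Reciprocal polynomials *)

Section Flip.
Variables (F : fieldType) (n : nat) (lam : F).
Local Notation W := {fraction {mpoly F[n]}}.
Implicit Types p q : {mpoly F[n]}.

(* [X^d p(lam / X)] for [d] bounding the multidegree of [p] *)
Definition flip (d : 'X_{1..n}) p : {mpoly F[n]} :=
  \sum_(m <- msupp p) (p@_m * lam ^+ mdeg m) *: 'X_[d - m].

Lemma mcoeff_flip d p m : (forall u, u \in msupp p -> (u <= d)%MM) ->
  (m <= d)%MM -> (flip d p)@_(d - m) = p@_m * lam ^+ mdeg m.
Proof.
move=> pd md; rewrite /flip raddf_sum /= big_seq.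
rewrite (eq_bigr (fun u => if u == m then p@_m * lam ^+ mdeg m else 0)).
  rewrite -big_seq sum_uniq_pred1 // mcoeff_msupp.
  by case: eqP => //= ->; rewrite mul0r.
move=> u /pd ud; rewrite mcoeffZ mcoeffX.
have [->|um] := eqVneq u m; first by rewrite eqxx mulr1.
rewrite (_ : (_ == _) = false) ?mulr0 //; apply: contra_neqF um => /eqP e.
apply/mnmP => i; move: e => /mnmP /(_ i); rewrite !mnmBE.
by move: (mnm_lepP ud i) (mnm_lepP md i); clear; lia.
Qed.

Lemma msupp_flip d p m : m \in msupp (flip d p) -> (m <= d)%MM.
Proof.
move=> mf; apply/mnm_lepP => i; move: mf; rewrite mcoeff_msupp; apply: contraNT => lt.
rewrite /flip raddf_sum big1 //= => u _; rewrite mcoeffZ mcoeffX.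
rewrite (_ : (_ == _) = false) ?mulr0 //; apply: contraNF lt => /eqP <-.
by rewrite mnmBE leq_subr.
Qed.

(** Multiplication by [X^d] clears denominators: the substitution turns [X^m] into [lam^|m| / X^m],
    hence into [lam^|m| X^(d - m)]. *)
Lemma flipE d p (sigma : {rmorphism {mpoly F[n]} -> W}) :
  (forall u, u \in msupp p -> (u <= d)%MM) ->
  (forall a, sigma a%:MP = ratfun_const n a) ->
  (forall i, sigma 'X_i = ratfun_const n lam / ('X_i)%:F) ->
  sigma p * ('X_[d])%:F = (flip d p)%:F.
Proof.
move=> pd sC sX; rewrite [X in sigma X]mpolyE !rmorph_sum mulr_suml.
rewrite big_seq [RHS]big_seq; apply: eq_bigr => m mp.
rewrite -!mul_mpolyC !rmorphM /=.
rewrite sC.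
rewrite -!mulrA; congr (_ * _).
have nz (u : 'X_{1..n}) : ('X_[u])%:F != 0 :> W.
  rewrite tofrac_eq0; apply/eqP => /(congr1 (mcoeff u)) /eqP.
  by rewrite mcoeffX eqxx mcoeff0 oner_eq0.
have -> : sigma 'X_[m] = (((lam ^+ mdeg m)%:MP)%:F / ('X_[m])%:F : W).
  rewrite mdegE mpolyXE_id !rmorph_prod -prodfV expr_sum !rmorph_prod -big_split.
  by apply: eq_bigr => i _; rewrite !rmorphXn /= sX expr_div_n.
rewrite -{1}(submK (pd _ mp)) mpolyXD rmorphM /= -mulrA; congr (_ * _).
by rewrite mulrC mulfK.
Qed.

End Flip.

(** An orbit [O] on which [d] takes the value [v] contributes [#|O| * v] to the sum, which is even
    when [#|O|] is. *)
Lemma odd_orbit_of_odd_sum (n : nat) (S : {group 'S_n}) (d : 'I_n -> nat) :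
  (forall s, s \in S -> forall i, d (s i) = d i) -> odd (\sum_i d i) ->
  exists i, odd #|orbit 'P S i|.
Proof.
move=> dS; apply: contraPP => /forallNP ev.
rewrite (_ : (\sum_i d i)%N = (\sum_(i in [set: 'I_n]) d i)%N); last first.
  by apply: eq_bigl => i; rewrite inE.
have part : partition (orbit 'P S @: [set: 'I_n]) [set: 'I_n].
  by apply: orbit_partition; apply/actsP => s sS i; rewrite !inE.
rewrite (set_partition_big _ part) /=; apply/negP.
apply: (big_ind (fun m => ~~ odd m)) => // [a b|A]; first by rewrite oddD; do 2!case: odd.
case/imsetP => i _ ->.
rewrite (eq_bigr (fun=> d i)) ?sum_nat_const ?oddM.
  by move/negP/negbTE: (ev i) => ->.
by move=> j /orbitP[s sS <-]; apply: dS.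
Qed.

Section Parity.
Variables (F : fieldType) (n : nat) (S : {group 'S_n}) (lam : F).
Local Notation W := {fraction {mpoly F[n]}}.
Implicit Types p q : {mpoly F[n]}.

Lemma odd_orbit_of_covariant (sigma : {rmorphism W -> W}) (z : W) :
  (forall a : F, a ^+ 2 != lam) ->
  (forall a, sigma (ratfun_const n a) = ratfun_const n a) ->
  (forall i, sigma ('X_i)%:F = ratfun_const n lam / ('X_i)%:F) ->
  z != 0 -> sigma z = ratfun_const n lam / z ->
  (forall s, s \in S -> perm_act s z = z) ->
  exists i : 'I_n, odd #|orbit 'P S i|.
Proof.
move=> lamP sC sX z0 sz Sz.
have [p [q [q0 [ez lt]]]] : exists p q, q != 0 /\ (z = p%:F / q%:F /\ lowest_terms p q).
  have [a [b [b0 ->]]] := fraction_quotient z.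
  have [p [q [e [q0 lt]]]] := lowest_terms_exists a (@mpoly_factorial F n) b0.
  exists p, q; split=> //; split=> //.
  by apply/eqP; rewrite eqr_div ?tofrac_eq0 // -!tofracM e.
have {lt} lt := lt.2.
have qF : q%:F != 0 :> W by rewrite tofrac_eq0.
have pF : p%:F != 0 :> W by apply: contraNneq z0 => h; rewrite ez h mul0r.
have p0 : p != 0 by rewrite -tofrac_eq0.
(* The degrees are taken over [p] and [q] jointly, so that the same [X^d] clears both denominators
   in [sigma z]. *)
pose d := [multinom (\max_(m <- msupp p ++ msupp q) (m : 'X_{1..n}) i)%N | i < n].
have dle m i : m \in msupp p ++ msupp q -> (m i <= d i)%N.
  by move=> mm; rewrite mnmE; apply: leq_bigmax_seq.
have pd m : m \in msupp p -> (m <= d)%MM.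
  by move=> mp; apply/mnm_lepP => i; apply: dle; rewrite mem_cat mp.
have qd m : m \in msupp q -> (m <= d)%MM.
  by move=> mp; apply/mnm_lepP => i; apply: dle; rewrite mem_cat mp orbT.
have dP i : exists2 m, m \in msupp p ++ msupp q & m i = d i.
  rewrite mnmE; have : (0 < size (msupp p ++ msupp q))%N.
    rewrite size_cat ltn_addr //; case: (msupp p) (msupp_eq0 p) => //=.
    by rewrite (negbTE p0).
  elim: (msupp p ++ msupp q) => // m r IH _; rewrite big_cons.
  have [r0|r0] := posnP (size r).
    by exists m; rewrite ?inE ?eqxx // (size0nil r0) big_nil maxn0.
  have [m' m'r e] := IH r0.
  case: (leqP (m i) (m' i)) => [le|gt].
    by exists m'; rewrite ?inE ?m'r ?orbT // -e (maxn_idPr le).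
  by exists m; rewrite ?inE ?eqxx // -e (maxn_idPl (ltnW gt)).
have lam0 : lam != 0 by have := lamP 0; rewrite expr0n /= eq_sym.
have dS s : s \in S -> forall i, d (s i) = d i.
  suff H t : t \in S -> forall i, (d (t i) <= d i)%N.
    move=> sS i; apply/eqP; rewrite eqn_leq H //=.
    by have := H s^-1%g; rewrite groupV => /(_ sS (s i)); rewrite permK.
  move=> tS i; have := Sz t tS; rewrite ez perm_act_frac // => /eqP.
  rewrite eqr_div ?tofrac_eq0 ?msym_neq0 // -!tofracM tofrac_eq => /eqP e.
  have [c [cp cq]] := lt _ _ (esym e).
  have c0 : c != 0.
    by apply: contraNneq (msym_neq0 t p0) => h; rewrite cp h mul0r.
  have [a a0 [ap aq]] : exists2 a : F, a != 0 &
      msym t p = a *: p /\ msym t q = a *: q.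
    (* Permuting the variables preserves the total degree, so [c] has degree [0]. *)
    have ec : c = (c@_0)%:MP.
      apply/msize1_polyC; have le : (msize (msym t p) <= msize p)%N.
        rewrite msizeE; apply/bigmax_leqP_seq => m mt _.
        have := mcoeff_msupp (msym t p) m; rewrite mt mcoeff_sym => /esym.
        by rewrite -mcoeff_msupp => /msize_mdeg_lt; rewrite mdeg_mperm.
      move: le; rewrite cp msizeM // (mpolySpred _ p0).
      by move: (msize c) (msize p).-1; clear; lia.
    exists c@_0; last by rewrite cp cq -!mul_mpolyC -ec.
    by apply: contraNneq c0 => h; rewrite ec h mpolyC0.
  have st r m : msym t r = a *: r -> m \in msupp r ->
      [multinom m (t j) | j < n] \in msupp r.
    by rewrite !mcoeff_msupp -mcoeff_sym => ->; rewrite mcoeffZ => h; rewrite mulf_neq0.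
  have [m mm <-] := dP (t i).
  have -> : m (t i) = [multinom m (t j) | j < n] i by rewrite mnmE.
  by apply: dle; move: mm; rewrite !mem_cat => /orP[] h;
    rewrite ?(st _ _ ap h) ?(st _ _ aq h) ?orbT.
have key (E : fieldType) (A B P Q X l : E) : B != 0 -> P != 0 -> Q != 0 ->
    A / B = l / (P / Q) -> P * (A * X) = l * (B * X) * Q.
  move=> B0 P0 Q0 e; have -> : A = l / (P / Q) * B by rewrite -e divfK.
  by field; rewrite P0 Q0.
have key2 (l Q P A B a : F) :
    l * (Q * A) = a * P -> P * B = a * Q -> Q != 0 -> l * (B * A) = a ^+ 2.
  move=> e1 e2 Q0; apply: (mulIf Q0).
  have -> : l * (B * A) * Q = l * (Q * A) * B by ring.
  by rewrite e1 -mulrA e2; ring.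
have eflip : p * flip lam d p = (lam *: flip lam d q) * q.
  apply/eqP; rewrite -tofrac_eq -mul_mpolyC !tofracM.
  pose tau : {rmorphism {mpoly F[n]} -> W} := sigma \o @FracField.tofrac _.
  rewrite -(flipE (sigma := tau) pd sC sX) -(flipE (sigma := tau) qd sC sX) /=.
  have sq0 : sigma q%:F != 0 by rewrite fmorph_eq0; exact: qF.
  apply/eqP; apply: (key _ _ _ _ _ _ _ sq0 pF qF).
  rewrite -(fmorph_div sigma) -ez; exact: sz.
have [c [cq cp]] := lt _ _ eflip.
have c0 : c != 0.
  have mp : mlead p \in msupp p by rewrite mlead_supp.
  have := mcoeff_flip lam pd (pd _ mp); apply: contra_eqN => /eqP h.
  rewrite cp h mul0r mcoeff0 eq_sym mulf_neq0 ?expf_neq0 //.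
  by rewrite mleadc_eq0.
(* For each [i] the degree [d i] is attained in [p] or in [q], while the flipped polynomials have
   degree at most [d i]; hence [c] does not involve ['X_i]. *)
have ec : c = (c@_0)%:MP.
  apply: mpoly_const_of_partial_degree => u uc; apply/mnmP => i; rewrite mnm0E.
  have [m mm md] := dP i; move: u uc; move: mm; rewrite mem_cat => /orP[] mm.
    apply: (partial_degree_mul c0 (p := p) (N := d i)); last by exists m.
    move=> u; rewrite -cq => uf; apply: (mnm_lepP (msupp_flip (d := d) (p := q) _) i).
    by move: uf; rewrite (perm_mem (msuppZ _ lam0)); apply.
  apply: (partial_degree_mul c0 (p := q) (N := d i)); last by exists m.
  by move=> u; rewrite -cp => uf; apply: (mnm_lepP (msupp_flip uf) i).
move: cp cq c0; rewrite ec !mul_mpolyC mpolyC_eq0; move: (c@_0) => a cp cq a0.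
have [m mp] : exists m, m \in msupp q by exists (mlead q); rewrite mlead_supp.
have md := qd _ mp.
have e1 : lam * (q@_m * lam ^+ mdeg m) = a * p@_(d - m).
  by have := congr1 (mcoeff (d - m)) cq; rewrite !mcoeffZ mcoeff_flip.
have e2 : p@_(d - m) * lam ^+ mdeg (d - m) = a * q@_m.
  have := congr1 (mcoeff m) cp; rewrite mcoeffZ => <-.
  rewrite -(mcoeff_flip lam pd) ?lem_subr //; congr (_ @_ _).
  by apply/mnmP => i; rewrite !mnmBE; move: (mnm_lepP md i); clear; lia.
(* The coefficient of [q] at [m] is sent to that of [p] at [d - m] and back, with total weight
   [lam * lam^|m| * lam^|d - m|]. *)
have e3 : lam ^+ (mdeg d).+1 = a ^+ 2.
  rewrite -(submK md) mdegD exprS exprD.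
  have qm0 : q@_m != 0 by rewrite -mcoeff_msupp.
  exact: (key2 _ _ _ _ _ _ e1 e2 qm0).
apply: (odd_orbit_of_odd_sum dS); rewrite -mdegE.
apply: contrapT => /negP ev; have := odd_double_half (mdeg d).
rewrite (negbTE ev) add0n => eh.
have /negP[] := lamP (a / lam ^+ (mdeg d)./2).
rewrite expr_div_n -e3 -exprM muln2 eh exprS mulfK //.
by rewrite expf_neq0.
Qed.

End Parity.

(** * From a unirational parametrization to an odd orbit *)

Section CovariantPoint.
Variables (W : fieldType) (n : nat) (o0 o1 o2 : 'I_n) (X Y : 'I_n -> W).
Hypotheses (o01 : o0 != o1) (o02 : o0 != o2) (o12 : o1 != o2) (X_inj : injective X).

(* [z] is the preimage of infinity under the Moebius transformation that
   maps [X] to [Y]. *)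
Definition pole_of (z : W) : Prop := exists2 kappa, kappa != 0 &
  forall i j, X i - X j = kappa * (X i - z) * (X j - z) * (Y i - Y j).

(** Eliminating the constants shows that [(y - z) / (y - z')] takes the same value at [y = X o1] and
    at [y = X o2], which forces [z = z']. *)
Lemma pole_of_unique z z' : pole_of z -> pole_of z' -> z = z'.
Proof.
move=> [a a0 za] [b b0 zb].
have key : forall i, i != o0 -> Y i - Y o0 != 0 /\ X i - z != 0 /\ X i - z' != 0
    /\ X o0 - z != 0 /\ X o0 - z' != 0.
  move=> i i0; have X0 := sub_inj_neq0 X_inj i0.
  have := X0; rewrite za !mulf_eq0 !negb_or => /andP[/andP[/andP[_ h1] h2] h3].
  by have := X0; rewrite zb !mulf_eq0 !negb_or => /andP[/andP[/andP[_ h4] h5] _].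
have eq1 i : i != o0 -> a * (X i - z) * (X o0 - z) = b * (X i - z') * (X o0 - z').
  move=> /key[y0 _]; apply: (mulIf y0); by rewrite -za -zb.
have i1 : o1 != o0 by rewrite eq_sym.
have i2 : o2 != o0 by rewrite eq_sym.
have [_ [n1 [n1' [n0 n0']]]] := key _ i1; have [_ [n2 [n2' _]]] := key _ i2.
have e : (X o1 - z) * (X o2 - z') = (X o2 - z) * (X o1 - z').
  apply: (mulfI a0); apply: (mulIf n0); apply: (mulIf b0); apply: (mulIf n0').
  transitivity ((a * (X o1 - z) * (X o0 - z)) * (b * (X o2 - z') * (X o0 - z'))).
    by ring.
  by rewrite (eq1 _ i1) -(eq1 _ i2); ring.
have : (X o2 - X o1) * (z - z') = 0.
  have -> : (X o2 - X o1) * (z - z') =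
    (X o2 - z) * (X o1 - z') - (X o1 - z) * (X o2 - z') by ring.
  by rewrite e subrr.
have D21 : X o2 - X o1 != 0 by apply: sub_inj_neq0; rewrite // eq_sym.
move/eqP; rewrite mulf_eq0 (negbTE D21) /=.
by rewrite subr_eq0 => /eqP.
Qed.

Lemma pole_of_perm z (tau : {rmorphism W -> W}) (s : 'S_n) :
  (forall i, tau (X i) = X (s i)) -> (forall i, tau (Y i) = Y (s i)) ->
  pole_of z -> tau z = z.
Proof.
move=> tX tY zP; apply: pole_of_unique (zP); have [a a0 za] := zP.
exists (tau a); first by rewrite fmorph_eq0.
move=> i j; rewrite -[i](permKV s) -[j](permKV s) -!tX -!tY -!rmorphB -!rmorphM.
by rewrite -za.
Qed.

Variables (lam : W) (sigma : {rmorphism W -> W}).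
Hypotheses (lam0 : lam != 0) (X0 : forall i, X i != 0).
Hypotheses (sX : forall i, sigma (X i) = lam / X i) (sY : forall i, sigma (Y i) = Y i).

(** Applying [sigma] makes [sigma z] a pole for the points [lam / X i]; undoing the inversion makes
    [lam / sigma z] a pole for [X], and uniqueness concludes. *)
Lemma pole_of_involution z : pole_of z -> z != 0 /\ sigma z = lam / z.
Proof.
move=> zP; have [a a0 za] := zP.
have sza i j : lam / X i - lam / X j =
    sigma a * (lam / X i - sigma z) * (lam / X j - sigma z) * (Y i - Y j).
  by rewrite -!sX -(sY i) -(sY j) -!rmorphB -!rmorphM -za.
have z0 : z != 0.
  (* With [z = 0], the equation and its image under [sigma] would make [X i * X o0] the same for all
     [i != o0]. *)
  apply/eqP => z0; move: za sza; rewrite z0 rmorph0 => za sza.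
  have c i : i != o0 -> a * X i * X o0 = - sigma a * lam.
    move=> i0; have D0 := sub_inj_neq0 X_inj i0.
    have := za i o0; rewrite !subr0 => e1.
    have y0 : Y i - Y o0 != 0 by apply: contraNneq D0 => h; rewrite e1 h mulr0.
    apply: (mulIf y0); rewrite -e1.
    have := sza i o0; rewrite !subr0 => e2.
    have -> : X i - X o0 = - (lam / X i - lam / X o0) * (X i * X o0) / lam.
      by field; rewrite lam0 !X0.
    by rewrite e2; field; rewrite lam0 !X0.
  have : a * X o1 * X o0 = a * X o2 * X o0 by rewrite !c // eq_sym.
  move/(mulIf (X0 o0))/(mulfI a0)/X_inj/eqP; exact/negP.
split=> //; have sz0 : sigma z != 0 by rewrite fmorph_eq0.
suff e : z = lam / sigma z by rewrite [in RHS]e invf_div mulrCA mulfV ?mulr1.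
apply: pole_of_unique (zP) _.
exists (- (sigma a * sigma z ^+ 2 / lam)).
  by rewrite oppr_eq0 !mulf_neq0 ?invr_eq0 ?expf_neq0 // fmorph_eq0.
move=> i j; have := sza i j => e.
have -> : X i - X j = - (lam / X i - lam / X j) * (X i * X j) / lam.
  by field; rewrite lam0 !X0.
by rewrite e; field; rewrite lam0 sz0 !X0.
Qed.

(** The identity [aff] says that [g] is an affine function of [X]; the pole is its zero. *)
Lemma pole_of_exists (g : 'I_n -> W) (kappa : W) :
  kappa != 0 -> (forall i, g i != 0) ->
  (forall i j, X i - X j = kappa * g i * g j * (Y i - Y j)) -> exists z, pole_of z.
Proof.
move=> k0 g0 Xg.
have aff i j l : (X i - X j) * g l + (X j - X l) * g i + (X l - X i) * g j = 0.
  by rewrite !Xg; ring.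
have D01 : X o0 - X o1 != 0 by apply: sub_inj_neq0.
(* A constant [g] would make [X] affine in [Y], with pole at infinity. Since [sigma] fixes [Y] and
   inverts [X], this again forces [X o1 = X o2]. *)
have [e01|n01] := eqVneq (g o0) (g o1).
  have gc l : g l = g o0.
    have := aff o0 o1 l; rewrite -e01 => e.
    have : (X o0 - X o1) * (g l - g o0) = 0 by rewrite -[RHS]e; ring.
    by move/eqP; rewrite mulf_eq0 (negbTE D01) subr_eq0 => /eqP.
  pose rho := kappa * g o0 ^+ 2.
  have Xr i j : X i - X j = rho * (Y i - Y j) by rewrite Xg !gc /rho; ring.
  have rho0 : rho != 0 by rewrite mulf_neq0 ?expf_neq0.
  have c i : i != o0 -> sigma rho * (X i * X o0) = - lam * rho.
    move=> i0; have D0 := sub_inj_neq0 X_inj i0.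
    have y0 : Y i - Y o0 != 0 by apply: contraNneq D0 => h; rewrite Xr h mulr0.
    have e : lam / X i - lam / X o0 = sigma rho * (Y i - Y o0).
      by rewrite -!sX -(sY i) -(sY o0) -!rmorphB -rmorphM -Xr.
    apply: (mulIf y0).
    have -> : sigma rho * (X i * X o0) * (Y i - Y o0) =
      (sigma rho * (Y i - Y o0)) * (X i * X o0) by ring.
    rewrite -e -mulrA -Xr; by field; rewrite !X0.
  have : sigma rho * (X o1 * X o0) = sigma rho * (X o2 * X o0) by rewrite !c // eq_sym.
  move/mulfI; rewrite fmorph_eq0 => /(_ rho0)/(mulIf (X0 o0))/X_inj/eqP.
  by rewrite (negbTE o12).
pose gam := (g o0 - g o1) / (X o0 - X o1).
have gam0 : gam != 0 by rewrite mulf_neq0 ?invr_eq0 // subr_eq0.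
pose z := X o0 - g o0 / gam.
have gE l : g l = gam * (X l - z).
  have e : (X o0 - X o1) * g l = g o0 * (X l - X o1) - g o1 * (X l - X o0).
    apply/eqP; rewrite -subr_eq0 -[X in _ == X](aff o0 o1 l); apply/eqP; ring.
  have -> : gam * (X l - z) = gam * (X l - X o0) + g o0 by rewrite /z; field.
  by apply: (mulfI D01); rewrite e /gam; field.
exists z; exists (kappa * gam ^+ 2); first by rewrite mulf_neq0 ?expf_neq0.
by move=> i j; rewrite Xg !gE; ring.
Qed.

End CovariantPoint.

Definition ratfun_cst (n : nat) (F : fieldType) :
    {rmorphism F -> {fraction {mpoly F[n]}}} := @FracField.tofrac _ \o @mpolyC n F.

Lemma ratfun_X_neq0 (n : nat) (F : fieldType) (i : 'I_n) :
  ('X_i)%:F != 0 :> {fraction {mpoly F[n]}}.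
Proof.
rewrite tofrac_eq0; apply/eqP => /(congr1 (mcoeff U_(i))) /eqP.
by rewrite mcoeffX eqxx mcoeff0 oner_eq0.
Qed.

(** The two sides of [p ^+ 2 = 'X_i * q ^+ 2] have total degrees of different parity. *)
Lemma ratfun_X_nonsquare (n : nat) (F : fieldType) (i : 'I_n)
    (a : {fraction {mpoly F[n]}}) : a ^+ 2 != ('X_i)%:F.
Proof.
have [p [q [q0 ->]]] := fraction_quotient a.
have qF : q%:F != 0 :> {fraction {mpoly F[n]}} by rewrite tofrac_eq0.
apply/eqP; rewrite expr_div_n => /(canRL (divfK (expf_neq0 2 qF))).
rewrite -!tofracXn -tofracM => /eqP; rewrite tofrac_eq => /eqP e.
have X0 : 'X_i != 0 :> {mpoly F[n]} by rewrite -tofrac_eq0 ratfun_X_neq0.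
have p0 : p != 0 by apply: contraNneq q0 => p0; move/esym/eqP: e;
  rewrite p0 expr0n /= mulf_eq0 (negbTE X0) expf_eq0.
have := congr1 (fun r : {mpoly F[n]} => msize r) e.
rewrite !expr2 !msizeM ?mulf_neq0 // msizeX mdeg1 (mpolySpred _ p0) (mpolySpred _ q0).
by move: (msize p).-1 (msize q).-1; clear; lia.
Qed.

(** Flipping moves the coefficients and multiplies them by powers of [lam], so none is lost; [d] is
    merely a large enough bound. *)
Lemma mmap_inversion_inj (n : nat) (F : fieldType) (lam : F) (p : {mpoly F[n]}) :
  lam != 0 ->
  mmap (ratfun_cst n F) (fun i => ratfun_const n lam / ('X_i)%:F) p = 0 -> p = 0.
Proof.
move=> lam0 p0; pose d := [multinom msize p | i < n].
have pd u : u \in msupp p -> (u <= d)%MM.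
  move=> up; apply/mnm_lepP => i; rewrite mnmE (leq_trans _ (ltnW (msize_mdeg_lt up))) //.
  by rewrite mdegE (bigD1 i) //= leq_addr.
pose sigma : {rmorphism {mpoly F[n]} -> {fraction {mpoly F[n]}}} :=
  mmap (ratfun_cst n F) (fun i => ratfun_const n lam / ('X_i)%:F).
have sC a : sigma a%:MP = ratfun_const n a by rewrite /sigma /= mmapC.
have sX i : sigma 'X_i = ratfun_const n lam / ('X_i)%:F.
  by rewrite /sigma /= mmapX mmap1U.
have := flipE pd sC sX; rewrite /sigma /= p0 mul0r => /esym/eqP.
rewrite tofrac_eq0 => /eqP f0; apply/mpolyP => m; rewrite mcoeff0.
have [mp|] := boolP (m \in msupp p); last by rewrite -mcoeff_eq0 => /eqP.
have := mcoeff_flip lam pd (pd _ mp); rewrite f0 mcoeff0 => /esym/eqP.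
by rewrite mulf_eq0 expf_eq0 (negbTE lam0) andbF orbF => /eqP.
Qed.

Lemma common_denominator (R : idomainType) (s : seq {fraction R}) :
  exists2 D : R, D != 0 & forall x, x \in s -> exists f : R, x * D%:F = f%:F.
Proof.
elim: s => [|x s [D D0 Ds]]; first by exists 1; rewrite ?oner_neq0.
have [p [q [q0 ->]]] := fraction_quotient x.
have qF : q%:F != 0 :> {fraction R} by rewrite tofrac_eq0.
exists (q * D) => [|y]; first by rewrite mulf_neq0.
rewrite inE => /orP[/eqP ->|/Ds [f e]].
  by exists (p * D); rewrite !tofracM mulrA divfK.
by exists (q * f); rewrite !tofracM mulrCA e.
Qed.

(** * Adjoining [r + 1] indeterminates to the constants *)

Section BaseChange.
Variables (k : fieldType) (n r : nat).
Local Notation Ln := {fraction {mpoly k[n]}}.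
Local Notation k' := {fraction {mpoly k[r.+1]}}.
Local Notation W := {fraction {mpoly k'[n]}}.

Definition extension_cst : {rmorphism k -> W} := ratfun_cst n k' \o ratfun_cst r.+1 k.

(** The parameters use the first [r] indeterminates of [k']; the last one, ['X_ord_max], is reserved
    for [lam]. *)
Definition indeterminate (l : 'I_r) : W :=
  ratfun_const n ('X_(widen_ord (leqnSn r) l))%:F.

Lemma mmap_extension (p : {mpoly k[n]}) :
  mmap extension_cst (fun i => ('X_i)%:F) p = (map_mpoly (ratfun_cst r.+1 k) p)%:F :> W.
Proof.
pose f : {rmorphism {mpoly k[n]} -> W} := mmap extension_cst (fun i => ('X_i)%:F).
pose g : {rmorphism {mpoly k[n]} -> W} :=
  @FracField.tofrac _ \o @map_mpoly n k k' (ratfun_cst r.+1 k).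
have : f =1 g.
  apply: mpoly_rmorph_eq => [a|i] /=; first by rewrite mmapC map_mpolyC.
  by rewrite mmapX mmap1U map_mpolyX.
exact.
Qed.

Lemma base_extension_exists : exists j : {rmorphism Ln -> W},
  (forall p : {mpoly k[n]}, j p%:F = (map_mpoly (ratfun_cst r.+1 k) p)%:F) /\
  (forall a, j (ratfun_const n a) = extension_cst a) /\
  (forall i, j (Lx k i) = Lx k' i).
Proof.
have [|j [jp [jc jX]]] := @ratfun_lift_exists n k W extension_cst (fun i => ('X_i)%:F).
  move=> p; rewrite mmap_extension => /eqP; rewrite tofrac_eq0 => /eqP e.
  apply/mpolyP => m; have := congr1 (mcoeff m) e.
  by rewrite mcoeff_map_mpoly !mcoeff0 => /eqP; rewrite fmorph_eq0 => /eqP.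
by exists j; split=> // p; rewrite jp mmap_extension.
Qed.

(** After clearing denominators in [Ln], coefficients are compared first at the monomials in the
    [x_i], then at those in the parameters. *)
Lemma parameter_independent (j : {rmorphism Ln -> W}) (P : {mpoly Ln[r]}) :
  (forall p : {mpoly k[n]}, j p%:F = (map_mpoly (ratfun_cst r.+1 k) p)%:F) ->
  mmap j indeterminate P = 0 -> P = 0.
Proof.
move=> jE P0.
have [D D0 DP] := common_denominator [seq P@_m | m <- msupp P].
have DF : D%:F != 0 :> Ln by rewrite tofrac_eq0.
have /choice[f fE] : forall m, exists g : {mpoly k[n]}, P@_m * D%:F = g%:F.
  move=> m; have [mP|mP] := boolP (m \in msupp P); first by apply: DP; apply: map_f.
  by exists 0; rewrite (memN_msupp_eq0 mP) mul0r tofrac0.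
have tE m : mmap1 indeterminate m = ratfun_const n ('X_[mnmwiden m])%:F :> W.
  rewrite /mmap1 -mwidenX mpolyXE_id rmorph_prod.
  rewrite [RHS](rmorph_prod (ratfun_cst n k' \o @FracField.tofrac _)).
  by apply: eq_bigr => l _; rewrite !rmorphXn /= mwidenX mnmwiden1.
have e : \sum_(m <- msupp P) ('X_[mnmwiden m] : {mpoly k[r.+1]})%:F *:
    map_mpoly (ratfun_cst r.+1 k) (f m) = 0.
  apply/eqP; rewrite -tofrac_eq0; apply/eqP.
  have := congr1 (fun w => w * j D%:F) P0; rewrite mul0r => <-.
  rewrite /mmap rmorph_sum mulr_suml; apply: eq_bigr => m _.
  rewrite -mul_mpolyC rmorphM /= -jE -fE rmorphM /= tE /ratfun_const.
  by rewrite [RHS]mulrAC [RHS]mulrC.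
have f0 m : m \in msupp P -> f m = 0.
  move=> mP; apply/mpolyP => u; rewrite mcoeff0.
  have : \sum_(v <- msupp P) (f v)@_u *: ('X_[mnmwiden v] : {mpoly k[r.+1]}) = 0.
    apply/eqP; rewrite -tofrac_eq0 rmorph_sum; apply/eqP.
    have := congr1 (mcoeff u) e; rewrite raddf_sum mcoeff0 /= => e'; rewrite -[RHS]e'.
    apply: eq_bigr => v _; rewrite mcoeffZ mcoeff_map_mpoly -mul_mpolyC /=.
    by rewrite rmorphM mulrC.
  move/(congr1 (mcoeff (mnmwiden m))); rewrite raddf_sum mcoeff0 /=.
  rewrite (eq_bigr (fun v => if v == m then (f m)@_u else 0)).
    by rewrite sum_uniq_pred1 // mP.
  move=> v _; rewrite mcoeffZ mcoeffX (inj_eq (@inj_mnmwiden r)).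
  by case: eqP => [->|]; rewrite ?mulr1 ?mulr0.
apply/mpolyP => m; rewrite mcoeff0.
have [mP|/memN_msupp_eq0 //] := boolP (m \in msupp P).
by have /eqP := fE m; rewrite f0 // tofrac0 mulf_eq0 (negbTE DF) orbF => /eqP.
Qed.

End BaseChange.

Lemma inversion_cross_ratio (E : fieldType) (l a b c d : E) :
  l != 0 -> a != 0 -> b != 0 -> c != 0 -> d != 0 -> d - b != 0 -> c - a != 0 ->
  (l / d - l / a) * (l / c - l / b) / ((l / d - l / b) * (l / c - l / a)) =
  (d - a) * (c - b) / ((d - b) * (c - a)).
Proof.
move=> l0 a0 b0 c0 d0 db ca.
have e (u v : E) : u != 0 -> v != 0 -> l / u - l / v = - (l * (u - v)) / (u * v).
  by move=> u0 v0; field; rewrite u0 v0.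
rewrite !e //; field.
by rewrite a0 b0 c0 d0 ca db !oppr_eq0 !mulf_neq0.
Qed.

Lemma mmap_map_mpoly (n : nat) (A B : nzRingType) (C : comNzRingType)
    (v : {rmorphism A -> B}) (j : {rmorphism B -> C}) (h : 'I_n -> C) (p : {mpoly A[n]}) :
  mmap (j \o v) h p = mmap j h (map_mpoly v p).
Proof.
apply: (mpoly_rmorph_eq (f := mmap (j \o v) h) (g := mmap j h \o map_mpoly v)) => [a|i].
  by rewrite /= map_mpolyC !mmapC.
by rewrite /= map_mpolyX !mmapX.
Qed.

Section UnirationalOddOrbit.
Variables (k : fieldType) (n r : nat) (S : {group 'S_n}).
Local Notation Ln := {fraction {mpoly k[n]}}.
Local Notation k' := {fraction {mpoly k[r.+1]}}.
Local Notation W := {fraction {mpoly k'[n]}}.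
Local Notation act := (fun s : 'S_n => (perm_act s : {rmorphism Ln -> Ln})).

Lemma invariant_eltP f : reflect (invariant_elt S act f) (f \in Ln_inv S).
Proof. by apply: (iffP forall_inP) => H s sS; apply/eqP; apply: H. Qed.

Lemma unirational_map_exists (phi : {rmorphism LnS k S -> {fraction {mpoly (KnS k S)[r]}}})
    (j : {rmorphism Ln -> W}) :
  (forall a, phi (KnS_to_LnS k S a) = ratfun_const r a) ->
  (forall p : {mpoly k[n]}, j p%:F = (map_mpoly (ratfun_cst r.+1 k) p)%:F) ->
  exists chi : Ln -> W,
  [/\ forall f g, f \in Ln_inv S -> g \in Ln_inv S -> chi (f - g) = chi f - chi g,
      forall f g, f \in Ln_inv S -> g \in Ln_inv S -> chi (f * g) = chi f * chi g,
      forall f, f \in Kn_inv S -> chi f = j f &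
      forall tau : {rmorphism W -> W}, (forall a, a \in Kn_inv S -> tau (j a) = j a) ->
        (forall l, tau (indeterminate k n l) = indeterminate k n l) ->
        forall f, tau (chi f) = chi f].
Proof.
move=> phiE jE.
pose v : {rmorphism KnS k S -> Ln} := \val.
have [|Psi [_ [Psic PsiX]]] :=
    @ratfun_lift_exists r (KnS k S) W (j \o v) (@indeterminate k n r).
  move=> P P0; have e : mmap j (@indeterminate k n r) (map_mpoly v P) = 0.
    by rewrite -mmap_map_mpoly.
  have {}e := parameter_independent jE e.
  apply/mpolyP => m; have := congr1 (mcoeff m) e.
  by rewrite mcoeff_map_mpoly !mcoeff0 => /eqP; rewrite fmorph_eq0 => /eqP.
(* Outside the fixed field [insubd] returns the default [0], so that [chi] is a total function but a
   morphism only on invariant elements. *)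
pose res (f : Ln) : LnS k S := insubd (0 : LnS k S) f.
have resE f : f \in Ln_inv S -> val (res f) = f by move=> fS; apply: insubdK.
exists (fun f => Psi (phi (res f))); split.
- move=> f g fS gS; rewrite -!rmorphB; congr (Psi (phi _)); apply: val_inj.
  by rewrite rmorphB /= !resE // rpredB.
- move=> f g fS gS; rewrite -!rmorphM; congr (Psi (phi _)); apply: val_inj.
  by rewrite rmorphM /= !resE // rpredM.
- move=> f fK; have fS : f \in Ln_inv S by apply: Kn_inv_sub.
  pose a : KnS k S := Sub f fK.
  have -> : res f = KnS_to_LnS k S a by apply: val_inj; rewrite resE.
  by rewrite phiE Psic.
- move=> tau tK tX f.
  apply: (ratfun_rmorph_eq (f := tau \o Psi) (g := Psi)) => [a|i] /=.
    rewrite Psic; exact: (tK _ (valP a)).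
  by rewrite PsiX; apply: tX.
Qed.

Lemma base_extension_perm (j : {rmorphism Ln -> W}) (s : 'S_n) :
  (forall a, j (ratfun_const n a) = extension_cst k n r a) ->
  (forall i, j (Lx k i) = Lx k' i) ->
  forall f, perm_act s (j f) = j (perm_act s f).
Proof.
move=> jC jX.
apply: (ratfun_rmorph_eq (f := perm_act s \o j) (g := j \o perm_act s)) => [a|i] /=.
  by rewrite perm_act_const jC; apply: perm_act_const.
by rewrite -!/(Lx k _) jX !perm_act_Lx jX.
Qed.

Lemma inversion_exists (lam : k') : lam != 0 ->
  exists sigma : {rmorphism W -> W},
    (forall a, sigma (ratfun_const n a) = ratfun_const n a) /\
    (forall i, sigma (Lx k' i) = ratfun_const n lam / Lx k' i).
Proof.
move=> lam0.
have [|sigma [_ [sC sX]]] := @ratfun_lift_exists n k' W (ratfun_cst n k')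
    (fun i => ratfun_const n lam / ('X_i)%:F).
  by move=> p; apply: mmap_inversion_inj.
by exists sigma.
Qed.

(** Inversion is a Moebius transformation, hence preserves the cross-ratios that generate the
    field. *)
Lemma inversion_Kn (j : {rmorphism Ln -> W}) (sigma : {rmorphism W -> W}) (lam : W) :
  (forall a, j (ratfun_const n a) = extension_cst k n r a) ->
  (forall i, j (Lx k i) = Lx k' i) -> lam != 0 ->
  (forall a, sigma (ratfun_const n a) = ratfun_const n a) ->
  (forall i, sigma (Lx k' i) = lam / Lx k' i) ->
  forall f, f \in Kn k n -> sigma (j f) = j f.
Proof.
move=> jC jX lam0 sC sX.
apply: (generated_subfield_ind (P := fun f => sigma (j f) = j f)).
- move=> f [[a ->]|[a [b [c [i [a0 b1 c2 i3 ->]]]]]].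
    by rewrite jC sC.
  have X0 (l : 'I_n) : Lx k' l != 0 by apply: ratfun_X_neq0.
  rewrite /cross_ratio !(fmorph_div, rmorphM, rmorphB) /= !jX !sX.
  have D0 := sub_inj_neq0 (@Lx_inj k' n).
  apply: (inversion_cross_ratio lam0 (X0 a) (X0 b) (X0 c) (X0 i)); apply: D0.
    by rewrite -val_eqE /= b1; lia.
  by rewrite -val_eqE /= a0 c2.
- by rewrite !rmorph1.
- by move=> f g fE gE; rewrite !rmorphB /= fE gE.
- by move=> f g fE gE; rewrite !fmorph_div /= fE gE.
Qed.

End UnirationalOddOrbit.

Lemma cocycle_quotient (E : fieldType) (A B a b a' b' c d e : E) :
  A != 0 -> B != 0 -> b != 0 -> b' != 0 ->
  A * d = c * (a * a') -> B * e = c * (b * b') ->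
  d = B / A * (a / b) * (a' / b') * e.
Proof.
move=> A0 B0 b0 b0' Ad Be; apply: (mulfI A0).
have -> : A * (B / A * (a / b) * (a' / b') * e) = (B * e) * ((a / b) * (a' / b')).
  by field; rewrite b0 b0' A0.
by rewrite Ad Be; field; rewrite b0 b0'.
Qed.

Lemma rmorph_cocycle (E E' : fieldType) (f : {rmorphism E -> E'}) (C a b c d e : E) :
  C * (a - b) = c * (d * e) -> f C * (f a - f b) = f c * (f d * f e).
Proof. by move=> h; rewrite -rmorphB -!rmorphM h. Qed.

Lemma unirational_odd_orbit (k : fieldType) (n : nat) (S : {group 'S_n}) :
  (5 <= n)%N -> unirational_ext (KnS_to_LnS k S) -> exists i : 'I_n, odd #|orbit 'P S i|.
Proof.
move=> n5 [r [phi phiE]].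
pose Ln := {fraction {mpoly k[n]}}.
pose k' := {fraction {mpoly k[r.+1]}}; pose W := {fraction {mpoly k'[n]}}.
pose o0 := Ordinal (leq_trans (isT : 1 <= 5)%N n5).
pose o1 := Ordinal (leq_trans (isT : 2 <= 5)%N n5).
pose o2 := Ordinal (leq_trans (isT : 3 <= 5)%N n5).
have o0E : o0 = 0%N :> nat by []. have o1E : o1 = 1%N :> nat by [].
have o2E : o2 = 2%N :> nat by [].
have o01 : o0 != o1 by []. have o02 : o0 != o2 by []. have o12 : o1 != o2 by [].
have [j [jE [jC jX]]] := base_extension_exists k n r.
have [chi [chiB chiM chiK chitau]] := unirational_map_exists phiE jE.
pose lam : k' := ('X_ord_max)%:F; have lam0 : lam != 0 by apply: ratfun_X_neq0.
have [sigma [sC sX]] := inversion_exists n lam0.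
have lamW0 : ratfun_const n lam != 0 by rewrite (fmorph_eq0 (ratfun_cst n k')).
have sK := inversion_Kn jC jX lamW0 sC sX.
pose act (s : 'S_n) : {rmorphism Ln -> Ln} := perm_act s.
have inv f : invariant_elt S act f <-> f \in Ln_inv S by split => /invariant_eltP.
have faithful s : s \in S -> s != 1%g -> exists2 f, f \in Kn k n & act s f != f.
  by move=> _ s1; have [f fK fs] := Kn_faithful k o0E o1E o2E n5 s1; exists f.
have [|||psi [psiK psitau]] := descent_extension_exists (act := act)
    (@perm_act1 k n) (@perm_actM k n)
    (perm_act_Kn o0E o1E o2E)
    faithful (j := j) (chi := chi).
- by move=> f g /inv fS /inv gS; apply: chiB.
- by move=> f g /inv fS /inv gS; apply: chiM.
- by move=> f /inv fS fK; apply: chiK; apply/andP.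
have psiS s : s \in S -> forall f, perm_act s (psi f) = psi (act s f).
  move=> sS; apply: psitau => // [f _|a _]; last exact: (base_extension_perm s jC jX).
  apply: chitau => [a /andP[_ /inv aS]|l]; last exact: perm_act_const.
  transitivity (j (perm_act s a)); first exact: (base_extension_perm s jC jX).
  congr (j _); exact: aS.
(* Equivariance with [s = 1]: [sigma] fixes the image of [K] under [j] and all values of [chi]. *)
have psis f : sigma (psi f) = psi f.
  rewrite (psitau 1%g sigma (group1 S)); first by rewrite /act /= perm_act1.
    move=> g _; apply: chitau => [a /andP[aK _]|l]; [exact: sK|exact: sC].
  by move=> a aK; rewrite /act /= perm_act1; apply: sK.
pose X i : W := Lx k' i; pose Y i : W := psi (Lx k i).
have X_inj : injective X by apply: Lx_inj.
pose C := cr_const o0 o1 o2 (@Lx k n); pose e i := cr_factor o0 o1 o2 (@Lx k n) i.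
have C0 : C != 0 by apply: cr_const_neq0 => //; apply: Lx_inj.
have e0 i : e i != 0 by apply: cr_factor_neq0 => //; apply: Lx_inj.
(* Since [psi] and [j] agree on the coefficients [cr_coef], comparing the two images of the
   splitting of [x_i - x_l] relates the differences of [X] to those of [Y], with these factors. *)
pose g i := j (e i) / psi (e i); pose kappa := psi C / j C.
have f0 (f : {rmorphism Ln -> W}) c : c != 0 -> f c != 0 by rewrite fmorph_eq0.
have g0 i : g i != 0.
  by apply: mulf_neq0; rewrite ?invr_eq0; apply: f0; exact: e0.
have kappa0 : kappa != 0.
  by apply: mulf_neq0; rewrite ?invr_eq0; apply: f0; exact: C0.
have Xg i l : X i - X l = kappa * g i * g l * (Y i - Y l).
  have N : C * (Lx k i - Lx k l) = cr_coef o0 o1 o2 (@Lx k n) i l * (e i * e l).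
    by apply: cr_coef_spec => //; apply: Lx_inj.
  have cE := psiK _ (cr_coef_in_Kn k o0E o1E o2E i l).
  have Nj := rmorph_cocycle j N; have Np := rmorph_cocycle psi N.
  rewrite cE in Np; rewrite !jX in Nj.
  exact: (cocycle_quotient (f0 _ _ C0) (f0 _ _ C0) (f0 _ _ (e0 _)) (f0 _ _ (e0 _)) Nj Np).
have [z zP] := pole_of_exists o01 o02 o12 X_inj (@ratfun_X_neq0 n k') sX
  (fun i => psis _) kappa0 g0 Xg.
have [z0 sz] := pole_of_involution o01 o02 o12 X_inj lamW0 (@ratfun_X_neq0 n k') sX
  (fun i => psis _) zP.
apply: (odd_orbit_of_covariant (lam := lam) _ sC sX z0 sz) => [a|s sS].
- exact: ratfun_X_nonsquare.
- apply: (pole_of_perm o01 o02 o12 X_inj) zP => i; first exact: perm_act_Lx.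
  transitivity (psi (act s (Lx k i))); first exact: psiS.
  congr (psi _); exact: perm_act_Lx.
Qed.

(** * From an odd orbit to a rational parametrization *)

Lemma rmorph_scale_quotient (E : fieldType) (f : {rmorphism E -> E}) (P Q c a b : E) m :
  P != 0 -> c != 0 -> b != 0 -> f P = P * Q ->
  f (P / c ^+ m * a) / (P / c ^+ m * b) = Q * (f a / b) / (f c / c) ^+ m.
Proof.
move=> P0 c0 b0 fP; have fc0 : f c != 0 by rewrite fmorph_eq0.
rewrite !rmorphM fmorphV rmorphXn fP /= expr_div_n.
have := (expf_neq0 m c0, expf_neq0 m fc0).
move: (c ^+ _) (f c ^+ _) => d d' [d0 d0'].
by field; rewrite P0 b0 d0 d0'.
Qed.

(** * Invariant affine forms *)

Section InvariantForms.
Variables (L : fieldType) (n : nat) (S : {group 'S_n}).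
Variable act : 'S_n -> {rmorphism L -> L}.
Hypothesis act1 : forall f, act 1%g f = f.
Hypothesis actM : forall s t f, act (s * t)%g f = act t (act s f).
Variable K : divringClosed L.
Hypothesis actK : forall s f, f \in K -> act s f \in K.
Hypothesis act_faithful :
  forall s, s \in S -> s != 1%g -> exists2 f, f \in K & act s f != f.
Variables (o0 o1 o2 : 'I_n) (x : 'I_n -> L).
Hypotheses (o01 : o0 != o1) (o02 : o0 != o2) (o12 : o1 != o2) (x_inj : injective x).
Hypothesis act_x : forall s i, act s (x i) = x (s i).
Local Notation C := (cr_const o0 o1 o2 x).
Local Notation e := (cr_factor o0 o1 o2 x).
Local Notation N := (cr_coef o0 o1 o2 x).
Hypothesis NK : forall i j, N i j \in K.

Let C0 : C != 0. Proof. exact: cr_const_neq0. Qed.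
Let e0 i : e i != 0. Proof. exact: cr_factor_neq0. Qed.
Let a0 s f : f != 0 -> act s f != 0. Proof. by rewrite fmorph_eq0. Qed.

(** The image under [s] of the splitting of [x_i - x_j] is divided by the splitting of
    [x_(s i) - x_(s j)]; the differences cancel. *)
Lemma factor_cocycle s i j : i != j ->
  exists2 u, u \in K &
    (act s (e i) / e (s i)) * (act s (e j) / e (s j)) = act s C / C * u /\ u != 0.
Proof.
move=> ij; have sij : s i != s j by rewrite (inj_eq perm_inj).
have h1 := rmorph_cocycle (act s) (cr_coef_spec o01 o02 o12 x_inj i j).
have h2 := cr_coef_spec o01 o02 o12 x_inj (s i) (s j).
rewrite !act_x in h1; have D0 := sub_inj_neq0 x_inj sij.
have n1 : act s (N i j) != 0 by apply/a0/cr_coef_neq0.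
have n2 : N (s i) (s j) != 0 by apply: cr_coef_neq0.
exists (N (s i) (s j) / act s (N i j)); first by rewrite rpred_div ?actK.
split; last by rewrite mulf_neq0 ?invr_eq0.
move: (act s C) (act s (e i)) (act s (e j)) (act s (N i j)) h1 n1 => c ei ej u h1 n1.
move: (N _ _) n2 h2 => v n2 h2; move: (e0 (s i)) (e0 (s j)) h2.
move: (e (s i)) (e (s j)) => fi fj fi0 fj0 h2.
have -> : c = u * (ei * ej) / (x (s i) - x (s j)) by rewrite -h1 mulfK.
have c0 := C0; have -> : C = v * (fi * fj) / (x (s i) - x (s j)) by rewrite -h2 mulfK.
by field; rewrite fi0 fj0 n1 n2 D0.
Qed.

(* Put [eps_j = s(e_j) / e_(s j)].  Up to [K] the [eps_j] are all equal, with square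
   [s(C) / C]; as [#|O|] is odd, [s(H) / H] is then [eps_j ^-1] up to [K]. *)
Lemma invariant_scale_exists (O : {set 'I_n}) : odd #|O| ->
  (forall s, s \in S -> forall i, (s i \in O) = (i \in O)) ->
  exists2 H, H != 0 & forall s, s \in S -> forall i, act s (H * e i) / (H * e (s i)) \in K.
Proof.
move=> oddO OS; set l := #|O|./2.
have cardO : #|O| = l.*2.+1 by rewrite -[LHS]odd_double_half oddO.
pose H := (\prod_(j in O) e j) / C ^+ l.+1.
have P0 : \prod_(j in O) e j != 0 by apply/prodf_neq0 => j _.
have H0 : H != 0 by rewrite mulf_neq0 // invr_eq0 expf_neq0.
exists H => // s sS i; pose eps j := act s (e j) / e (s j).
have eps0 j : eps j != 0 by rewrite mulf_neq0 ?invr_eq0 ?a0.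
have mu j : exists2 m, m \in K & eps j = eps o0 * m.
  have [->|j0] := eqVneq j o0; first by exists 1; rewrite ?rpred1 ?mulr1.
  (* Only products of two distinct [eps] are controlled, so [eps j] and [eps o0] are compared
     through a third index. *)
  have [m mj m0] : exists2 m, m != j & m != o0.
    have [->|j1] := eqVneq j o1; [exists o2|exists o1]; by rewrite eq_sym.
  have [u uK [eu u0]] := factor_cocycle s mj; have [v vK [ev v0]] := factor_cocycle s m0.
  exists (u / v); first by rewrite rpred_div.
  apply: (mulfI (eps0 m)); rewrite [LHS]eu mulrA [eps m * eps o0]ev.
  by rewrite -[RHS]mulrA [v * _]mulrC divfK.
have [nu nuK nuE] : exists2 u, u \in K & eps o0 ^+ 2 = act s C / C * u.
  have [u uK [eu u0]] := factor_cocycle s o01; have [m mK em] := mu o1.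
  have m0 : m != 0 by apply: contraNneq (eps0 o1) => h; rewrite em h mulr0.
  exists (u / m); first by rewrite rpred_div.
  by rewrite mulrA -eu -/(eps o0) -/(eps o1) em; field.
have [m mE] := choice (fun j => let: ex_intro2 m a b := mu j in ex_intro _ m (conj a b)).
have sP : act s (\prod_(j in O) e j) = (\prod_(j in O) e j) * \prod_(j in O) eps j.
  rewrite rmorph_prod [X in _ = X * _](reindex_inj (@perm_inj _ s)) /=.
  rewrite [X in _ = X * _](eq_bigl (mem O)) => [|j]; last by rewrite /= OS.
  by rewrite -big_split; apply: eq_bigr => j _; rewrite /eps /= mulrCA mulfV ?mulr1.
have -> : act s (H * e i) / (H * e (s i)) =
    (\prod_(j in O) eps j) * eps i / (act s C / C) ^+ l.+1.
  exact: rmorph_scale_quotient.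
have c0 : act s C / C != 0 by rewrite mulf_neq0 ?invr_eq0 ?a0.
have -> : \prod_(j in O) eps j = eps o0 ^+ #|O| * \prod_(j in O) m j.
  by rewrite -prodr_const -big_split; apply: eq_bigr => j _; case: (mE j).
have [mi ei] := mE i; rewrite ei.
(* Here oddness enters: [#|O| + 1 = 2 (l + 1)], so the power of [eps o0] is [(eps o0 ^+ 2) ^+ l.+1]
   and cancels [(s(C) / C) ^+ l.+1] up to [K]. *)
have -> : eps o0 ^+ #|O| * \prod_(j in O) m j * (eps o0 * m i) / (act s C / C) ^+ l.+1 =
    nu ^+ l.+1 * (\prod_(j in O) m j) * m i.
  have -> : eps o0 ^+ #|O| * \prod_(j in O) m j * (eps o0 * m i) =
     (eps o0 ^+ 2) ^+ l.+1 * (\prod_(j in O) m j * m i).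
    have -> : (eps o0 ^+ 2) ^+ l.+1 = eps o0 * eps o0 ^+ #|O|.
      by rewrite -exprM cardO -exprS mul2n doubleS.
    by move: (eps o0 ^+ #|O|) => t; ring.
  by rewrite nuE exprMn; field; rewrite expf_neq0.
rewrite rpredM // rpredM ?rpredX //; apply: rpred_prod => j _; by case: (mE j).
Qed.

Lemma invariant_forms_exist (O : {set 'I_n}) : odd #|O| ->
  (forall s, s \in S -> forall i, (s i \in O) = (i \in O)) ->
  exists p q r : L, exists w Y Z : 'I_n -> L,
  [/\ [/\ invariant_elt S act p, invariant_elt S act q & invariant_elt S act r],
      p * r - q != 0, forall i, Y i \in K /\ Z i \in K &
      forall i, p * x i + q = Y i * w i /\ x i + r = Z i * w i].
Proof.
move=> oddO OS; have [H H0 HS] := invariant_scale_exists oddO OS.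
pose V (a b : L) := forall i, exists2 c, c \in K & a * x i + b = c * (H * e i).
have w0 i : H * e i != 0 by rewrite mulf_neq0.
have VD a b a' b' : V a b -> V a' b' -> V (a + a') (b + b').
  move=> Va Va' i; have [c cK h] := Va i; have [c' cK' h'] := Va' i.
  by exists (c + c'); rewrite ?rpredD // [RHS]mulrDl -h -h'; ring.
have VK c a b : c \in K -> V a b -> V (c * a) (c * b).
  move=> cK Va i; have [d dK h] := Va i.
  by exists (c * d); rewrite ?rpredM // -[RHS]mulrA -h; ring.
have VS s a b : s \in S -> V a b -> V (act s a) (act s b).
  move=> sS Va i; rewrite -[i](permKV s); set j := (s^-1)%g i.
  have [c cK h] := Va j; exists (act s c * (act s (H * e j) / (H * e (s j)))).
    by rewrite rpredM ?actK ?HS.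
  transitivity (act s (a * x j + b)); first by rewrite rmorphD rmorphM act_x.
  by rewrite h [LHS]rmorphM -[RHS]mulrA divfK.
have V0 : V 0 0 by move=> i; exists 0; rewrite ?rpred0 // !mul0r addr0.
have VT c a b : c \in K -> V a b -> V (trace S act (c * a)) (trace S act (c * b)).
  move=> cK Va; rewrite /trace.
  apply: (big_ind2 (fun a b => V a b)) => // s sS.
  by apply: VS => //; apply: VK.
(* The form [(H C / e_j) (X - x_j)] takes the value [N i j * (H * e i)] at [x_i]. Those for [o0] and
   [o1] are linearly independent over [L]. *)
have VB j : V (H * C / e j) (- (H * C / e j * x j)).
  move=> i; exists (N i j) => //; rewrite -mulrBr.
  transitivity (H / e j * (C * (x i - x j))); first by ring.
  by rewrite cr_coef_spec //; field.
have [E EP] := dual_family_exists act1 actM actK act_faithful.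
have EK c : c \in E -> c.2 \in K by case/EP.1.
have [a1 [b1 [a2 [b2 [i1 i2 V1 V2 det]]]]] : exists a1 b1 a2 b2,
    [/\ invariant_elt S act a1 /\ invariant_elt S act b1,
        invariant_elt S act a2 /\ invariant_elt S act b2, V a1 b1, V a2 b2 &
        a1 * b2 - a2 * b1 != 0].
  (* If every pair of traced forms had determinant [0], expanding the coefficients of the forms for
     [o0] and [o1] in the dual family would make these two forms dependent. *)
  apply: contrapT => no.
  pose A j := H * C / e j; pose B j := - (A j * x j).
  have zero c c' : c \in E -> c' \in E ->
      trace S act (c.2 * A o0) * trace S act (c'.2 * B o1) -
      trace S act (c'.2 * A o1) * trace S act (c.2 * B o0) = 0.
    move=> /EK cK /EK cK'; apply: contrapT => /eqP nz; apply: no.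
    do 4!eexists; split; last exact: nz; try (split; exact: trace_invariant);
      by apply: VT => //; apply: VB.
  have det0 : A o0 * B o1 - A o1 * B o0 = 0.
    rewrite -[A o0](dual_family_expand act1 EP) -[B o1](dual_family_expand act1 EP).
    rewrite -[A o1](dual_family_expand act1 EP) -[B o0](dual_family_expand act1 EP).
    rewrite !big_distrlr /= [X in _ - X]exchange_big /= -sumrB.
    rewrite big_seq big1 // => c cE; rewrite -sumrB big_seq big1 // => c' cE'.
    have h := zero _ _ cE cE'.
    set t1 := trace _ _ _ in h *; set t2 := trace _ _ _ in h *.
    set t3 := trace _ _ _ in h *; set t4 := trace _ _ _ in h *.
    transitivity ((t1 * t2 - t3 * t4) * (c.1 * c'.1)); first by ring.
    by rewrite h mul0r.
  have A0 j : A j != 0 by apply: mulf_neq0; [exact: mulf_neq0|rewrite invr_eq0].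
  have : A o0 * A o1 * (x o0 - x o1) = 0 by rewrite -det0 /B; ring.
  move/eqP; apply/negP.
  exact: mulf_neq0 (mulf_neq0 (A0 _) (A0 _)) (sub_inj_neq0 x_inj o01).
have {i1 i2} [i1 i1' i2 i2'] : [/\ invariant_elt S act a1, invariant_elt S act b1,
    invariant_elt S act a2 & invariant_elt S act b2] by case: i1 i2 => ? ? [].
(* The second form is about to be divided by its leading coefficient [a2]; the determinant ensures
   that [a1] or [a2] is nonzero. *)
wlog a20 : a1 b1 a2 b2 V1 V2 det i1 i1' i2 i2' / a2 != 0.
  move=> gen; have [a20|a20] := eqVneq a2 0; last exact: (gen a1 b1 a2 b2).
  apply: (gen a2 b2 a1 b1) => //.
    by rewrite -oppr_eq0 opprB.
  by apply: contraNneq det => a10; rewrite a20 a10 !mul0r subrr.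
have invdiv a b : invariant_elt S act a -> invariant_elt S act b ->
    invariant_elt S act (a / b).
  by move=> ia ib s sS; rewrite fmorph_div /= ia ?ib.
have /choice[Y YP] : forall i, exists c, c \in K /\ a1 * x i + b1 = c * (H * e i).
  by move=> i; have [c ? ?] := V1 i; exists c.
have /choice[Z ZP] : forall i, exists c, c \in K /\ a2 * x i + b2 = c * (H * e i).
  by move=> i; have [c ? ?] := V2 i; exists c.
exists (a1 / a2), (b1 / a2), (b2 / a2), (fun i => H * e i / a2), Y, Z; split.
- by split; apply: invdiv.
- have -> : a1 / a2 * (b2 / a2) - b1 / a2 = (a1 * b2 - a2 * b1) / a2 ^+ 2 by field.
  by rewrite mulf_neq0 // invr_eq0 expf_neq0.
- by move=> i; have [? _] := YP i; have [? _] := ZP i.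
- move=> i; have [_ h] := YP i; have [_ h'] := ZP i.
  have wE c : c * (H * e i / a2) = c * (H * e i) / a2 by rewrite mulrA.
  by rewrite !wE -h -h'; split; field.
Qed.

End InvariantForms.

(** * Rigidity of Moebius transformations *)

Lemma quadratic_three_roots (E : fieldType) (a b c u v w : E) :
  u != v -> u != w -> v != w ->
  a * u ^+ 2 + b * u + c = 0 -> a * v ^+ 2 + b * v + c = 0 ->
  a * w ^+ 2 + b * w + c = 0 -> [/\ a = 0, b = 0 & c = 0].
Proof.
move=> uv uw vw eu ev ew.
have Duv : u - v != 0 by rewrite subr_eq0.
have Duw : u - w != 0 by rewrite subr_eq0.
have Dvw : v - w != 0 by rewrite subr_eq0.
have e1 : a * (u + v) + b = 0.
  apply: (mulIf Duv); rewrite mul0r -[RHS](subrr (a * u ^+ 2 + b * u + c)) {2}eu -ev; ring.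
have e2 : a * (u + w) + b = 0.
  apply: (mulIf Duw); rewrite mul0r -[RHS](subrr (a * u ^+ 2 + b * u + c)) {2}eu -ew; ring.
have a0 : a = 0.
  by apply: (mulIf Dvw); rewrite mul0r -[RHS](subrr (a * (u + v) + b)) {2}e1 -e2; ring.
move: e1 eu; rewrite a0 !mul0r !add0r => b0; rewrite b0 mul0r add0r => c0.
by split.
Qed.

(** The difference of the two cross-multiplied sides is a polynomial of degree at most two with
    three roots, so its coefficients vanish. *)
Lemma moebius_unique (E : fieldType) (p q r t0 t1 t2 u v w : E) :
  u != v -> u != w -> v != w -> t0 * t2 != t1 ->
  (p * u + q) * (u + t2) = (t0 * u + t1) * (u + r) ->
  (p * v + q) * (v + t2) = (t0 * v + t1) * (v + r) ->
  (p * w + q) * (w + t2) = (t0 * w + t1) * (w + r) ->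
  [/\ p = t0, q = t1 & r = t2].
Proof.
move=> uv uw vw t eu ev ew.
have H y : (p * y + q) * (y + t2) = (t0 * y + t1) * (y + r) ->
    (p - t0) * y ^+ 2 + (p * t2 + q - t0 * r - t1) * y + (q * t2 - t1 * r) = 0.
  by move=> h; rewrite -[RHS](subrr ((p * y + q) * (y + t2))) {2}h; ring.
have [/eqP] := quadratic_three_roots uv uw vw (H _ eu) (H _ ev) (H _ ew).
rewrite subr_eq0 => /eqP -> e1 e2.
have tn : t0 * t2 - t1 != 0 by rewrite subr_eq0.
have er : r = t2.
  apply/eqP; rewrite -subr_eq0; apply/eqP; apply: (mulIf tn); rewrite mul0r.
  have -> : (r - t2) * (t0 * t2 - t1) =
    (q * t2 - t1 * r) - t2 * (t0 * t2 + q - t0 * r - t1) by ring.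
  by rewrite e1 e2; ring.
split=> //; apply/eqP; rewrite -subr_eq0 -[X in _ == X]e1 er; apply/eqP; ring.
Qed.

(** Both [(a, b)] and [(a', b')] are proportional to the nonzero vector [(y, z)]. *)
Lemma proportional_transfer (E : fieldType) (y z a b a' b' : E) :
  (y != 0) || (z != 0) -> z * a = y * b -> z * a' = y * b' -> a * b' = a' * b.
Proof.
move=> yz e e'; have [z0|z0] := eqVneq z 0.
  move: e e' yz; rewrite z0 !mul0r eqxx orbF => /esym/eqP + /esym/eqP + y0.
  by rewrite !mulf_eq0 (negbTE y0) /= => /eqP -> /eqP ->; rewrite !mulr0.
by apply: (mulfI z0); rewrite mulrA e mulrA e' [y * b']mulrC -!mulrA [b * b']mulrC; ring.
Qed.

(* [(t2 u - t1 v) / (t0 v - u)] is the image of [u / v] under the inverse of the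
   Moebius transformation [y |-> (t0 y + t1) / (y + t2)]. *)
Lemma inverse_moebius (E : fieldType) (t0 t1 t2 u v y z : E) :
  t0 * v - u != 0 -> z * u = y * v ->
  let xi := (t2 * u - t1 * v) / (t0 * v - u) in z * (t0 * xi + t1) = y * (xi + t2).
Proof.
move=> d0 e /=.
have -> : t0 * ((t2 * u - t1 * v) / (t0 * v - u)) + t1 = (t0 * t2 - t1) / (t0 * v - u) * u.
  by field.
have -> : (t2 * u - t1 * v) / (t0 * v - u) + t2 = (t0 * t2 - t1) / (t0 * v - u) * v.
  by field.
by rewrite mulrCA e mulrCA.
Qed.

Lemma inverse_moebius_sub (E : fieldType) (t0 t1 t2 u v u' v' : E) :
  t0 * v - u != 0 -> t0 * v' - u' != 0 ->
  (t2 * u - t1 * v) / (t0 * v - u) - (t2 * u' - t1 * v') / (t0 * v' - u') =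
  (t0 * t2 - t1) * (t0 * v - u)^-1 * (t0 * v' - u')^-1 * (u * v' - u' * v).
Proof. by move=> d0 d0'; field; rewrite d0 d0'. Qed.

Lemma cross_ratio_scaled (E : fieldType) (I : Type) (kappa : E) (h x xi : I -> E) a b c d :
  kappa != 0 -> (forall i, h i != 0) ->
  (forall i j, xi i - xi j = kappa * h i * h j * (x i - x j)) ->
  x d - x b != 0 -> x c - x a != 0 ->
  (xi d - xi a) * (xi c - xi b) / ((xi d - xi b) * (xi c - xi a)) =
  (x d - x a) * (x c - x b) / ((x d - x b) * (x c - x a)).
Proof.
move=> k0 h0 H db ca; rewrite !H; field.
by rewrite db ca k0 !h0.
Qed.

Lemma generated_rmorph_eq (L E : fieldType) (A : L -> Prop) (f g : {rmorphism L -> E}) :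
  (forall a, A a -> f a = g a) -> forall a, a \in generated_subfield A -> f a = g a.
Proof.
move=> fg; apply: generated_subfield_ind => // [|a b ea eb|a b ea eb].
- by rewrite !rmorph1.
- by rewrite !rmorphB ea eb.
- by rewrite !fmorph_div ea eb.
Qed.

(** * Twisting the points by a generic Moebius transformation *)

Section Twist.
Variables (L T : fieldType) (n : nat) (c eta : {rmorphism L -> T}) (x : 'I_n -> L).
Variables (p q r : L) (t0 t1 t2 : T).
Let u i := p * x i + q.
Let v i := x i + r.
Let xi i := (t2 * c (u i) - t1 * c (v i)) / (t0 * c (v i) - c (u i)).
Hypotheses (pqr : p * r - q != 0) (x_inj : injective x) (t012 : t0 * t2 != t1).
Hypothesis D0 : forall i, t0 * c (v i) - c (u i) != 0.
Hypothesis etaX : forall i, eta (x i) = xi i.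

Let c_neq0 i j : i != j -> c (x i) - c (x j) != 0.
Proof. by move=> ij; rewrite -rmorphB fmorph_eq0; apply: sub_inj_neq0. Qed.

Let kappa := (t0 * t2 - t1) * c (p * r - q).
Let h i := (t0 * c (v i) - c (u i))^-1.

Let kappa0 : kappa != 0.
Proof. by apply: mulf_neq0; rewrite ?subr_eq0 // fmorph_eq0. Qed.

Let h0 i : h i != 0.
Proof. by rewrite invr_eq0; apply: D0. Qed.

Let xi_sub i j : xi i - xi j = kappa * h i * h j * (c (x i) - c (x j)).
Proof.
rewrite /xi (inverse_moebius_sub t1 t2 (D0 i) (D0 j)).
have -> : c (u i) * c (v j) - c (u j) * c (v i) = c (p * r - q) * (c (x i) - c (x j)).
  by rewrite -!rmorphM -!rmorphB -rmorphM; congr (c _); rewrite /u /v; ring.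
by rewrite /kappa /h; move: (t0 * t2 - t1) (c (p * r - q)) (_^-1) (_^-1) => *; ring.
Qed.

Lemma twist_cross_ratio i j l m : m != j -> l != i ->
  let cr := (x m - x i) * (x l - x j) / ((x m - x j) * (x l - x i)) in eta cr = c cr.
Proof.
move=> mj li; rewrite /= !fmorph_div !rmorphM !rmorphB /= !etaX.
by apply: (cross_ratio_scaled (x := fun i => c (x i)) kappa0 h0 xi_sub); apply: c_neq0.
Qed.

(** With [N] the matrix of [(p, q, r)] and [T] that of [(t0, t1, t2)], [N] sends [x i] to
    [Y i / Z i], which [eta] fixes. So both [eta N] and [T] send [xi i] to this point, and three
    points determine the matrix. *)
Lemma twist_matrix (o0 o1 o2 : 'I_n) (Y Z : 'I_n -> L) :
  o0 != o1 -> o0 != o2 -> o1 != o2 ->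
  (forall i, Z i * (p * x i + q) = Y i * (x i + r)) ->
  (forall i, (Y i != 0) || (Z i != 0)) ->
  (forall i, eta (Y i) = c (Y i)) -> (forall i, eta (Z i) = c (Z i)) ->
  [/\ eta p = t0, eta q = t1 & eta r = t2].
Proof.
move=> o01 o02 o12 YZ YZ0 etaY etaZ.
have key i : (eta p * xi i + eta q) * (xi i + t2) = (t0 * xi i + t1) * (xi i + eta r).
  apply: (@proportional_transfer _ (c (Y i)) (c (Z i))).
  - by rewrite !fmorph_eq0.
  - by rewrite -etaY -etaZ -etaX -!(rmorphM, rmorphD) YZ.
  - by apply: inverse_moebius => //; rewrite -!rmorphM; congr (c _); apply: YZ.
have xi_neq i j : i != j -> xi i != xi j.
  move=> ij; rewrite -subr_eq0 xi_sub.
  exact: mulf_neq0 (mulf_neq0 (mulf_neq0 kappa0 (h0 _)) (h0 _)) (c_neq0 ij).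
exact: (moebius_unique (xi_neq _ _ o01) (xi_neq _ _ o02) (xi_neq _ _ o12)
  t012 (key _) (key _) (key _)).
Qed.

End Twist.

Section GenericTwist.
Variables (k : fieldType) (n : nat) (o0 o1 o2 : 'I_n).
Hypotheses (o01 : o0 != o1) (o02 : o0 != o2) (o12 : o1 != o2).
Local Notation Ln := {fraction {mpoly k[n]}}.
Local Notation T := {fraction {mpoly Ln[3]}}.
Local Notation x := (@Lx k n).
Variables (p q r : Ln) (Y Z : 'I_n -> Ln).
Hypothesis pqr : p * r - q != 0.
Hypothesis YZK : forall i, Y i \in Kn k n /\ Z i \in Kn k n.
Hypothesis YZ : forall i, Z i * (p * x i + q) = Y i * (x i + r).
Hypothesis YZ0 : forall i, (Y i != 0) || (Z i != 0).

Definition three_values (E : fieldType) (a b c : E) (i : 'I_3) : E := nth 0 [:: a; b; c] i.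

Let j0 : 'I_3 := Ordinal (isT : (0 < 3)%N).
Let j1 : 'I_3 := Ordinal (isT : (1 < 3)%N).
Let j2 : 'I_3 := Ordinal (isT : (2 < 3)%N).

Lemma generic_twist_exists : exists eta : {rmorphism Ln -> T},
  (forall f, f \in Kn k n -> eta f = ratfun_const 3 f) /\
  (forall i : 'I_3, eta (three_values p q r i) = ('X_i)%:F).
Proof.
pose c : {rmorphism Ln -> T} := ratfun_cst 3 Ln.
pose t0 : T := ('X_j0)%:F; pose t1 : T := ('X_j1)%:F; pose t2 : T := ('X_j2)%:F.
pose u i := p * x i + q; pose v i := x i + r; pose pt := three_values p q r.
pose U i : {mpoly Ln[3]} := (u i) *: 'X_j2 - (v i) *: 'X_j1.
pose D i : {mpoly Ln[3]} := (v i) *: 'X_j0 - (u i)%:MP.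
have UE i : (U i)%:F = t2 * c (u i) - t1 * c (v i).
  by rewrite /U tofracB -!mul_mpolyC !tofracM; congr (_ - _); apply: mulrC.
have DE i : (D i)%:F = t0 * c (v i) - c (u i).
  by rewrite /D tofracB -!mul_mpolyC !tofracM; congr (_ - _); apply: mulrC.
(* At [T = N] the twist is the identity: [U i / D i] specializes to [x i]. The twisted points thus
   inherit algebraic independence over [k]. *)
have Dpt i : (D i).@[pt] = p * r - q.
  rewrite /D mevalB mevalZ mevalXU mevalC /pt /three_values /= /u /v; ring.
have Upt i : (U i).@[pt] = (p * r - q) * x i.
  by rewrite /U mevalB !mevalZ !mevalXU /pt /three_values /= /u /v; ring.
have Dpt0 i : (D i).@[pt] != 0 by rewrite Dpt.
have inj (F : {mpoly k[n]}) :
    mmap (ratfun_cst n k) (fun i => (U i).@[pt] / (D i).@[pt]) F = 0 -> F = 0.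
  have -> : (fun i => (U i).@[pt] / (D i).@[pt]) = (fun i => ('X_i)%:F).
    by apply: funext => i; rewrite Upt Dpt mulrC mulKf.
  have e : mmap (ratfun_cst n k) (fun i => ('X_i)%:F) F = F%:F.
    apply: (mpoly_rmorph_eq (f := mmap (ratfun_cst n k) (fun i => ('X_i)%:F))
      (g := @FracField.tofrac _)) => [a|i] /=; first by rewrite mmapC.
    by rewrite mmapX mmap1U.
  by rewrite e => /eqP; rewrite tofrac_eq0 => /eqP.
have ext := @specialize_independent n 3 k Ln (ratfun_cst n k) pt U D
  (c \o ratfun_cst n k) (fun _ => erefl) Dpt0 inj.
have [eta [_ [etaC etaX]]] := ratfun_lift_exists ext.
have D0 i : t0 * c (v i) - c (u i) != 0.
  rewrite -DE tofrac_eq0; apply: contraNneq (Dpt0 i) => h; by rewrite h meval0.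
pose xi i := (t2 * c (u i) - t1 * c (v i)) / (t0 * c (v i) - c (u i)).
have {}etaX i : eta (x i) = xi i by rewrite /xi -UE -DE; apply: etaX.
have t012 : t0 * t2 != t1.
  rewrite /t0 /t1 /t2 -tofracM tofrac_eq; apply/eqP.
  move/(congr1 (fun P => P.@[fun i : 'I_3 => (i != j1)%:R])) => /eqP.
  by rewrite mevalM !mevalXU /= mulr1 oner_eq0.
have etaK f : f \in Kn k n -> eta f = c f.
  apply: (generated_rmorph_eq (f := eta) (g := c)) => g.
  case=> [[a ->]|[a [b [d [i [a0 b1 d2 i3 ->]]]]]]; first exact: etaC.
  apply: (twist_cross_ratio pqr (@Lx_inj k n) t012 D0 etaX).
    by rewrite -val_eqE /= b1; move: i3; clear; lia.
  by rewrite -val_eqE /= a0 d2.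
exists eta; split; first exact: etaK.
have etaY i : eta (Y i) = c (Y i) by apply: etaK; case: (YZK i).
have etaZ i : eta (Z i) = c (Z i) by apply: etaK; case: (YZK i).
have [ep eq er] := twist_matrix pqr (@Lx_inj k n) t012 D0 etaX o01 o02 o12 YZ YZ0 etaY etaZ.
case=> -[|[|[|m]]] lt; rewrite /three_values /=.
- by rewrite ep; congr ('X__)%:F; apply: val_inj.
- by rewrite eq; congr ('X__)%:F; apply: val_inj.
- by rewrite er; congr ('X__)%:F; apply: val_inj.
- by [].
Qed.

End GenericTwist.

(** * Fields of invariants with given generators *)

Section InvariantsGenerated.
Variables (L : fieldType) (gT : finGroupType) (S : {group gT}).
Variable act : gT -> {rmorphism L -> L}.
Hypothesis act1 : forall f, act 1%g f = f.
Hypothesis actM : forall s t f, act (s * t)%g f = act t (act s f).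
Variable K : divringClosed L.
Hypothesis actK : forall s f, f \in K -> act s f \in K.
Hypothesis act_faithful :
  forall s, s \in S -> s != 1%g -> exists2 f, f \in K & act s f != f.
Variable M : L -> Prop.
Hypothesis M_inv : forall f, M f -> invariant_elt S act f.
Hypothesis M_K : forall f, f \in K -> invariant_elt S act f -> M f.
Hypothesis M_sub : forall f g, M f -> M g -> M (f - g).
Hypothesis M_mul : forall f g, M f -> M g -> M (f * g).
Hypothesis M_V : forall f, M f -> M f^-1.

Let span (f : L) : Prop := exists r : seq (L * L),
  (forall c, c \in r -> M c.1 /\ c.2 \in K) /\ f = \sum_(c <- r) c.1 * c.2.

Let M1 : M 1.
Proof. by apply: M_K => [|s sS]; rewrite ?rpred1 ?rmorph1. Qed.

Let M0 : M 0.
Proof. by rewrite -(subrr 1); apply: M_sub. Qed.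

Let MN f : M f -> M (- f).
Proof. by rewrite -sub0r; apply: M_sub. Qed.

Let MD f g : M f -> M g -> M (f + g).
Proof. by move=> Mf Mg; rewrite -[g]opprK; apply: M_sub => //; apply: MN. Qed.

Let span_mul f g : span f -> span g -> span (f * g).
Proof.
move=> [r [rP ->]] [r' [rP' ->]].
exists [seq (c.1 * d.1, c.2 * d.2) | c <- r, d <- r']; split.
  move=> _ /allpairsP[[c d] /= [/rP[? ?] /rP'[? ?] ->]].
  by split; [exact: M_mul|exact: rpredM].
rewrite big_distrlr /= big_allpairs_dep /=; apply: eq_bigr => c _; apply: eq_bigr => d _.
by rewrite mulrACA.
Qed.

Let span_M f : M f -> span f.
Proof.
move=> Mf; exists [:: (f, 1)]; split; last by rewrite big_seq1 /= mulr1.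
by move=> c; rewrite inE => /eqP ->; rewrite rpred1.
Qed.

Let span_act s f : s \in S -> span f -> span (act s f).
Proof.
move=> sS [r [rP ->]]; exists [seq (c.1, act s c.2) | c <- r]; split.
  by move=> _ /mapP[c /rP[? ?] ->]; split=> //; apply: actK.
rewrite big_map rmorph_sum big_seq [RHS]big_seq; apply: eq_bigr => c /rP[Mc _].
by rewrite rmorphM /= (M_inv Mc).
Qed.

(** With [e] in [K] of trace [1], an invariant [f = sum m c] equals
    [trace (f e) = sum m * trace (c e)], and [trace (c e)] is an invariant element of [K], hence in
    [M]. *)
Let span_invariant f : span f -> invariant_elt S act f -> M f.
Proof.
move=> [r [rP fE]] fi; have [E EP] := dual_family_exists act1 actM actK act_faithful.
have [e eK e1] := trace1_exists act1 actM actK EP.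
have -> : f = \sum_(c <- r) c.1 * trace S act (c.2 * e).
  rewrite -[LHS]mulr1 -e1 -trace_linear // fE mulr_suml.
  rewrite /trace; under eq_bigr do rewrite rmorph_sum.
  rewrite exchange_big /= big_seq [RHS]big_seq; apply: eq_bigr => c /rP[/M_inv Mc _].
  by rewrite mulr_sumr; apply: eq_bigr => s sS; rewrite -mulrA rmorphM /= Mc.
rewrite big_seq; apply: (big_ind M) => // c /rP[Mc cK].
apply: M_mul => //; apply: M_K; last exact: trace_invariant.
by apply: trace_in_K; rewrite ?rpredM.
Qed.

Lemma invariants_generated :
  (forall P : L -> Prop, (forall f, f \in K -> P f) -> (forall f, M f -> P f) ->
    (forall f g, P f -> P g -> P (f - g)) -> (forall f g, P f -> P g -> P (f * g)) ->
    (forall f, P f -> P f^-1) -> forall f, P f) ->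
  forall f, invariant_elt S act f -> M f.
Proof.
move=> gen f; apply: span_invariant; apply: (gen span) f => //.
- move=> f fK; exists [:: (1, f)]; split; last by rewrite big_seq1 /= mul1r.
  by move=> c; rewrite inE => /eqP ->.
- move=> f g [r [rP ->]] [r' [rP' ->]].
  exists (r ++ [seq (- c.1, c.2) | c <- r']); split.
    move=> c; rewrite mem_cat => /orP[/rP //|/mapP[d /rP'[Md dK] ->]].
    by split=> //; apply: MN.
  rewrite big_cat big_map /= -sumrN; congr (_ + _).
  by apply: eq_bigr => c _; rewrite mulNr.
- move=> f fs; have [->|f0] := eqVneq f 0; first by rewrite invr0; apply: span_M.
  (* The norm of [f] is an invariant element of the span, so it lies in [M] and can be inverted
     there; the remaining conjugates of [f] stay in the span. *)
  pose N := \prod_(s in S) act s f.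
  have N_inv : invariant_elt S act N.
    move=> s sS; rewrite /N rmorph_prod [RHS](reindex_inj (mulIg s)).
    by apply: eq_big => [t|t _]; rewrite ?groupMr // actM.
  have prod_span (P : pred gT) : span (\prod_(s in S | P s) act s f).
    apply: (big_ind span) => // [|s /andP[sS _]]; first exact: span_M.
    exact: span_act.
  have MN' : M N.
    apply: span_invariant => //; have := prod_span xpredT.
    by rewrite /N (eq_bigl (fun s => s \in S)) // => s; rewrite andbT.
  have -> : f^-1 = N^-1 * \prod_(s in S | s != 1%g) act s f.
    have P0 : \prod_(s in S | s != 1%g) act s f != 0.
      by apply/prodf_neq0 => s _; rewrite fmorph_eq0.
    by rewrite /N (bigD1 1%g) ?group1 //= act1 invfM mulfVK.
  by apply: span_mul => //; apply: span_M; apply: M_V.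
Qed.

End InvariantsGenerated.

Lemma rmorph_mmap_eq (n : nat) (A C : nzRingType) (B D : comNzRingType)
    (c : {rmorphism A -> B}) (h : 'I_n -> B) (g : {rmorphism B -> D})
    (v : {rmorphism A -> C}) (t : {rmorphism {mpoly C[n]} -> D}) (P : {mpoly A[n]}) :
  (forall a, g (c a) = t (v a)%:MP) -> (forall i, g (h i) = t 'X_i) ->
  g (mmap c h P) = t (map_mpoly v P).
Proof.
move=> gC gX.
apply: (mpoly_rmorph_eq (f := g \o mmap c h) (g := t \o map_mpoly v)) => [a|i] /=.
  by rewrite mmapC map_mpolyC gC.
by rewrite mmapX mmap1U map_mpolyX gX.
Qed.

(** Solving for [x] eliminates [w]: each [x_i] lies in the field generated by [p], [q], [r] over
    [K]. *)
Lemma moebius_preimage (E : fieldType) (p q r x y z w : E) :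
  p * r - q != 0 -> p * x + q = y * w /\ x + r = z * w ->
  x = (y * r - z * q) / (z * p - y).
Proof.
move=> d0 [e1 e2]; have d : w * (z * p - y) = p * r - q.
  transitivity (p * (z * w) - y * w); first by ring.
  by rewrite -e1 -e2; ring.
have D0 : z * p - y != 0 by apply: contraNneq d0 => h; rewrite -d h mulr0.
have w0 : w != 0 by apply: contraNneq d0 => h; rewrite -d h mul0r.
apply: (mulIf D0); rewrite divfK //; apply: (mulIf w0).
have -> : (y * r - z * q) * w = (y * w) * r - (z * w) * q by ring.
have -> : x * (z * p - y) * w = x * (p * (z * w) - y * w) by ring.
by rewrite -e1 -e2; ring.
Qed.

Lemma odd_orbit_rational (k : fieldType) (n : nat) (S : {group 'S_n}) (i : 'I_n) :
  (5 <= n)%N -> odd #|orbit 'P S i| -> rational_ext (KnS_to_LnS k S).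
Proof.
move=> n5 oddO.
pose Ln := {fraction {mpoly k[n]}}.
pose o0 := Ordinal (leq_trans (isT : 1 <= 5)%N n5).
pose o1 := Ordinal (leq_trans (isT : 2 <= 5)%N n5).
pose o2 := Ordinal (leq_trans (isT : 3 <= 5)%N n5).
have o0E : o0 = 0%N :> nat by []. have o1E : o1 = 1%N :> nat by [].
have o2E : o2 = 2%N :> nat by [].
have o01 : o0 != o1 by []. have o02 : o0 != o2 by []. have o12 : o1 != o2 by [].
pose act (s : 'S_n) : {rmorphism Ln -> Ln} := perm_act s.
have inv f : invariant_elt S act f <-> f \in Ln_inv S by split => /invariant_eltP.
have faithful s : s \in S -> s != 1%g -> exists2 f, f \in Kn k n & act s f != f.
  by move=> _ s1; have [f fK fs] := Kn_faithful k o0E o1E o2E n5 s1; exists f.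
have actK : forall s f, f \in Kn k n -> act s f \in Kn k n.
  by move=> s f; apply: (perm_act_Kn o0E o1E o2E).
have OS s : s \in S -> forall j, (s j \in orbit 'P S i) = (j \in orbit 'P S i).
  move=> sS j; have /actsP/(_ s sS j) := acts_orbit 'P i (subsetT S).
  by rewrite /= apermE.
have [p [q [r [w [Y [Z [[ip iq ir] pqr YZK form]]]]]]] :=
  invariant_forms_exist (act := act) (@perm_act1 k n) (@perm_actM k n) actK faithful
    o01 o02 o12 (@Lx_inj k n) (@perm_act_Lx k n) (cr_coef_in_Kn k o0E o1E o2E) oddO OS.
have YZ l : Z l * (p * Lx k l + q) = Y l * (Lx k l + r).
  by have [-> ->] := form l; rewrite mulrCA.
have pqrE l : p * r - q = p * (Lx k l + r) - (p * Lx k l + q).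
  by move: (Lx k l) => y; ring.
have YZ0 l : (Y l != 0) || (Z l != 0).
  rewrite -negb_and; apply: contra pqr => /andP[/eqP Y0 /eqP Z0].
  by have [e1 e2] := form l; rewrite (pqrE l) e1 e2 Y0 Z0 !mul0r mulr0 subrr.
have [eta [etaK etaT]] := generic_twist_exists o01 o02 o12 pqr YZK YZ YZ0.
pose pv : 'I_3 -> LnS k S := three_values
  (Sub p (proj1 (inv p) ip)) (Sub q (proj1 (inv q) iq)) (Sub r (proj1 (inv r) ir)).
have pvE l : val (pv l) = three_values p q r l.
  by case: l => -[|[|[|l]]] lt; rewrite /pv /three_values /=.
pose vK : {rmorphism KnS k S -> Ln} := \val.
pose vL : {rmorphism LnS k S -> Ln} := \val.
(* Independence of [p], [q], [r]: [eta] maps them to the three indeterminates and embeds the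
   elements of [K] as constants. *)
have inj (P : {mpoly (KnS k S)[3]}) : mmap (KnS_to_LnS k S) pv P = 0 -> P = 0.
  move=> P0.
  have e : (map_mpoly vK P)%:F = eta (vL (mmap (KnS_to_LnS k S) pv P)).
    symmetry; apply: (rmorph_mmap_eq (g := eta \o vL) (t := @FracField.tofrac _)) => [a|l].
      by apply: etaK; case/andP: (valP a).
    transitivity (eta (three_values p q r l)); last exact: etaT.
    by congr (eta _); apply: pvE.
  move/eqP: e; rewrite P0 !rmorph0 tofrac_eq0 => /eqP e.
  apply/mpolyP => m; have := congr1 (mcoeff m) e.
  by rewrite mcoeff_map_mpoly !mcoeff0 => /eqP; rewrite fmorph_eq0 => /eqP.
have [phi [_ [phiC phiX]]] := ratfun_lift_exists inj.
exists 3, phi; split=> //.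
(* The image of [phi], a subfield of the invariants that contains [p], [q], [r] and the invariant
   elements of [K]; it remains to see that it is everything. *)
pose M (f : Ln) := exists F, vL (phi F) = f.
have Mpt l : M (three_values p q r l).
  by exists ('X_l)%:F; rewrite phiX; apply: pvE.
have MK f : f \in Kn k n -> invariant_elt S act f -> M f.
  move=> fK fi; have fKS : f \in Kn_inv S by apply/andP; split=> //; apply/inv.
  by exists (ratfun_const 3 (Sub f fKS : KnS k S)); rewrite phiC.
have MS f : invariant_elt S act f -> M f.
  apply: (invariants_generated (act := act) (@perm_act1 k n) (@perm_actM k n) actK faithful).
  - by move=> g [F <-]; apply/inv; apply: (valP (phi F)).
  - exact: MK.
  - by move=> g h [F <-] [G <-]; exists (F - G); rewrite !rmorphB.
  - by move=> g h [F <-] [G <-]; exists (F * G); rewrite !rmorphM.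
  - by move=> g [F <-]; exists F^-1; rewrite !fmorphV.
  move=> Q QK QM QB QM' QV; apply: Ln_generated => // [a|l].
    by apply: QK; apply: ratfun_const_in_Kn.
  have Qp : Q p by apply: QM; apply: (Mpt (Ordinal (isT : (0 < 3)%N))).
  have Qq : Q q by apply: QM; apply: (Mpt (Ordinal (isT : (1 < 3)%N))).
  have Qr : Q r by apply: QM; apply: (Mpt (Ordinal (isT : (2 < 3)%N))).
  have [QY QZ] : Q (Y l) /\ Q (Z l) by case: (YZK l) => ? ?; split; apply: QK.
  suff -> : Lx k l = (Y l * r - Z l * q) / (Z l * p - Y l).
    by apply: (QM'); [apply: (QB); apply: (QM')|apply: (QV); apply: (QB) => //; apply: (QM')].
  exact: moebius_preimage pqr (form l).
have surj f : exists F, phi F = f.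
  have [|F e] := MS (vL f); first by apply/inv; apply: (valP f).
  by exists F; apply: val_inj.
have [psi psiP] := choice surj.
by exists psi; [move=> F; apply: (fmorph_inj phi); rewrite psiP|exact: psiP].
Qed.

Theorem theorem2 (k : fieldType) (n : nat) (hn : (5 <= n)%N)
    (S : {group 'S_n}) :
  [<-> rational_ext (KnS_to_LnS k S);
       unirational_ext (KnS_to_LnS k S);
       exists i : 'I_n, odd #|orbit 'P S i| ].
Proof.
tfae.
- case=> r [phi [[psi phiK psiK] phiC]].
  have psiB : zmod_morphism psi.
    by move=> a b; apply: (can_inj phiK); rewrite rmorphB !psiK.
  have psiM : monoid_morphism psi.
    by split=> [|a b]; apply: (can_inj phiK); rewrite ?rmorph1 ?rmorphM !psiK.
  pose A := GRing.isZmodMorphism.Build _ _ psi psiB.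
  pose B := GRing.isMonoidMorphism.Build _ _ psi psiM.
  pose psi' : {rmorphism LnS k S -> {fraction {mpoly (KnS k S)[r]}}} := HB.pack psi A B.
  by exists r, psi' => a; rewrite -phiC /= phiK.
- exact: unirational_odd_orbit.
- by case=> i; apply: odd_orbit_rational.
Qed.
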